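(* Let $n$ mobile agents $1,\dots,n$ be placed on the real line at positions $a_1<a_2<\dots<a_n$ (given in this order), agent $i$ having initial energy $e(i)\ge 0$. For any two agents $p,q$, one can decide in $O(n)$ time whether the initial information of agent $p$ can be delivered to agent $q$, and, if this is possible, compute in $O(n)$ time a centralized schedule of agent movements (and energy transfers) performing this delivery.
   Context: Model: agents move continuously along the line (they may stop at any point), spending energy equal to the distance travelled; an agent can only move while it has energy left (energy never becomes negative). When two agents meet at the same point, one of them may transfer any portion of its current energy to the other, and they exchange all information they currently hold (after the meeting each holds the union). Initially each agent holds its own initial information. A centralized scheduler with full knowledge of the instance decides all moves. Delivery of the information of $p$ to $q$ means that at some moment agent $q$ holds the initial information of agent $p$. *)

(* Defs.v *)
From mathcomp Require Import all_boot all_order all_algebra.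
From mathcomp Require Import reals.

Set Implicit Arguments.
Unset Strict Implicit.
Unset Printing Implicit Defensive.

Import Order.TTheory GRing.Theory Num.Theory.
Local Open Scope ring_scope.

(* [Move i x]: agent i walks straight to the point x and stops there.
   [Transfer i j w]: agent i gives the amount w of its energy to agent j.
   A schedule is a finite sequence of actions. There are no speeds or deadlines,
   so only the order of the events matters and the agents move one at a time.   *)
Inductive action (R A : Type) :=
| Move of A & R
| Transfer of A & A & R.

Arguments Move {R A}.
Arguments Transfer {R A}.

Definition action_map (R A B : Type) (f : A -> B) (c : action R A) :
    action R B :=
  match c with
  | Move i x => Move (f i) x
  | Transfer i j w => Transfer (f i) (f j) w
  end.

Section Agents.
Variables (R : realType) (n : nat).

Record config := Config {
  pos : 'I_n -> R;
  energy : 'I_n -> R;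
  info : 'I_n -> {set 'I_n} (* the agents whose initial information is held *)
}.

Definition init_config (a e : 'I_n -> R) : config :=
  Config a e (fun i => [set i]).

Definition between (x y z : R) : bool := (x <= y <= z) || (z <= y <= x).

Definition legal (c : config) (act : action R 'I_n) : bool :=
  match act with
  | Move i x => `|x - pos c i| <= energy c i
  | Transfer i j w =>
      [&& i != j, pos c i == pos c j, 0 <= w & w <= energy c i]
  end.

(* A walking agent meets, in the order of its path, every agent standing on it,
   end points included. Hence when i walks from [pos c i] to x, each agent k that
   is on the path after the move (i itself, at its end, or an agent standing on
   it) ends up with the information of all the agents located on the part of the
   path from [pos c i] to k; this part contains i and k themselves.             *)
Definition perform (c : config) (act : action R 'I_n) : config :=
  match act with
  | Move i x =>
      let pos' k := if k == i then x else pos c k in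
      Config
        pos'
        (fun k => if k == i then energy c i - `|x - pos c i| else energy c k)
        (fun k => if between (pos c i) (pos' k) x
                  then \bigcup_(j | between (pos c i) (pos c j) (pos' k)) info c j
                  else info c k)
  | Transfer i j w =>
      Config
        (pos c)
        (fun k => if k == i then energy c i - w
                  else if k == j then energy c j + w
                  else energy c k)
        (info c)
  end.

Definition run (c : config) (s : seq (action R 'I_n)) : config :=
  foldl perform c s.

Fixpoint feasible (c : config) (s : seq (action R 'I_n)) : bool :=
  if s is act :: s' then legal c act && feasible (perform c act) s' else true.

Definition delivers (a e : 'I_n -> R) (p q : 'I_n) (s : seq (action R 'I_n)) :
    Prop :=
  feasible (init_config a e) s /\
  exists k : nat, p \in info (run (init_config a e) (take k s)) q.

Definition deliverable (a e : 'I_n -> R) (p q : 'I_n) : Prop :=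
  exists s : seq (action R 'I_n), delivers a e p q s.

End Agents.

(* A real RAM with unit-cost operations. It has finitely many banks of cells
   containing natural numbers and finitely many banks of cells containing reals,
   each bank being indexed by nat (a scalar variable is the cell 0 of some bank),
   and a write-only output tape of actions. The bank of an access is fixed in the
   program text, the index is computed. Programs contain no real constants other
   than natural numbers, and there is no conversion from reals to indices (no
   floor function).                                                             *)
Inductive nexpr :=
| NConst of nat
| NGet of nat & nexpr                 (* bank, index *)
| NAdd of nexpr & nexpr
| NSub of nexpr & nexpr.

Inductive rexpr :=
| RConst of nat
| RGet of nat & nexpr                 (* bank, index *)
| RAdd of rexpr & rexpr
| RSub of rexpr & rexpr
| RMul of rexpr & rexpr
| RDiv of rexpr & rexpr.

Inductive bexpr :=
| BNle of nexpr & nexpr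
| BRle of rexpr & rexpr
| BNot of bexpr
| BAnd of bexpr & bexpr.

Inductive cmd :=
| Skip
| NSet of nat & nexpr & nexpr         (* bank, index, value *)
| RSet of nat & nexpr & rexpr         (* bank, index, value *)
| EmitMove of nexpr & rexpr
| EmitTransfer of nexpr & nexpr & rexpr
| Seq of cmd & cmd
| If of bexpr & cmd & cmd
| While of bexpr & cmd.

Fixpoint ncost (x : nexpr) : nat :=
  match x with
  | NConst _ => 1
  | NGet _ y => (ncost y).+1
  | NAdd y z | NSub y z => (ncost y + ncost z).+1
  end.

Fixpoint rcost (x : rexpr) : nat :=
  match x with
  | RConst _ => 1
  | RGet _ y => (ncost y).+1
  | RAdd y z | RSub y z | RMul y z | RDiv y z => (rcost y + rcost z).+1
  end.

Fixpoint bcost (x : bexpr) : nat :=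
  match x with
  | BNle y z => (ncost y + ncost z).+1
  | BRle y z => (rcost y + rcost z).+1
  | BNot y => (bcost y).+1
  | BAnd y z => (bcost y + bcost z).+1
  end.

Section Machine.
Variable R : realType.

Record store := Store {
  nmem : nat -> nat -> nat;           (* bank, index *)
  rmem : nat -> nat -> R;             (* bank, index *)
  out : seq (action R nat)
}.

Definition upd (T : Type) (m : nat -> nat -> T) (b i : nat) (v : T) :
    nat -> nat -> T :=
  fun b' i' => if (b' == b) && (i' == i) then v else m b' i'.

Fixpoint neval (s : store) (x : nexpr) : nat :=
  match x with
  | NConst k => k
  | NGet b y => nmem s b (neval s y)
  | NAdd y z => (neval s y + neval s z)%N
  | NSub y z => (neval s y - neval s z)%N
  end.

Fixpoint reval (s : store) (x : rexpr) : R :=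
  match x with
  | RConst k => k%:R
  | RGet b y => rmem s b (neval s y)
  | RAdd y z => reval s y + reval s z
  | RSub y z => reval s y - reval s z
  | RMul y z => reval s y * reval s z
  | RDiv y z => reval s y / reval s z
  end.

Fixpoint beval (s : store) (x : bexpr) : bool :=
  match x with
  | BNle y z => (neval s y <= neval s z)%N
  | BRle y z => reval s y <= reval s z
  | BNot y => ~~ beval s y
  | BAnd y z => beval s y && beval s z
  end.

(* [exec c s t s']: started in s, the program c halts in s' after t steps. *)
Inductive exec : cmd -> store -> nat -> store -> Prop :=
| ExecSkip s : exec Skip s 1 s
| ExecNSet s b i x :
    exec (NSet b i x) s (ncost i + ncost x).+1
      (Store (upd (nmem s) b (neval s i) (neval s x)) (rmem s) (out s))
| ExecRSet s b i x :
    exec (RSet b i x) s (ncost i + rcost x).+1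
      (Store (nmem s) (upd (rmem s) b (neval s i) (reval s x)) (out s))
| ExecEmitMove s i x :
    exec (EmitMove i x) s (ncost i + rcost x).+1
      (Store (nmem s) (rmem s)
         (rcons (out s) (Move (neval s i) (reval s x))))
| ExecEmitTransfer s i j w :
    exec (EmitTransfer i j w) s (ncost i + ncost j + rcost w).+1
      (Store (nmem s) (rmem s)
         (rcons (out s) (Transfer (neval s i) (neval s j) (reval s w))))
| ExecSeq c1 c2 s s1 s2 t1 t2 :
    exec c1 s t1 s1 -> exec c2 s1 t2 s2 -> exec (Seq c1 c2) s (t1 + t2) s2
| ExecIf b c1 c2 s s' t :
    exec (if beval s b then c1 else c2) s t s' ->
    exec (If b c1 c2) s (bcost b + t).+1 s'
| ExecWhileDone b c s :
    ~~ beval s b -> exec (While b c) s (bcost b).+1 s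
| ExecWhileLoop b c s s1 s2 t1 t2 :
    beval s b -> exec c s t1 s1 -> exec (While b c) s1 t2 s2 ->
    exec (While b c) s (bcost b + t1 + t2).+1 s2.

(* Agents are numbered from 0. Input: n, p, q in cell 0 of the nat banks 0, 1, 2,
   the positions in the real bank 0 and the energies in the real bank 1; all the
   other cells are 0 and the output tape is empty.                              *)
Definition input (n : nat) (a e : 'I_n -> R) (p q : 'I_n) : store :=
  Store
    (fun b i => if i is 0 then nth 0%N [:: n; val p; val q] b else 0%N)
    (fun b i => match b with
                | 0 => oapp a 0 (insub i)
                | 1 => oapp e 0 (insub i)
                | _ => 0
                end)
    [::].

Definition answer (s : store) : bool := nmem s 3 0 != 0%N.

Definition outputs (n : nat) (st : store) (s : seq (action R 'I_n)) : Prop :=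
  out st = [seq action_map (@nat_of_ord n) act | act <- s].

End Machine.

(* Main.v *)
Require Import Defs.
From mathcomp Require Import all_boot all_order all_algebra.
From mathcomp Require Import reals.
From mathcomp Require Import ring lra zify.

Set Implicit Arguments.
Unset Strict Implicit.
Unset Printing Implicit Defensive.

Import Order.TTheory GRing.Theory Num.Theory.
Local Open Scope ring_scope.

(* Call lo and hi the leftmost and the rightmost of p and q. For a point x, let
   f(x) be the net energy carried across x from left to right by a schedule.
   Between two agents f decreases at a rate at least the number of crossings of
   x; if x is crossed only once, and rightwards, then f(x) >= 0. Left of the
   point y where the information reaches q, either the information of p (if
   p < q) or q itself (if q < p) crosses every point of [lo, y] rightwards, so
   there f decreases at rate 1 while it is positive and at rate 2 afterwards;
   with the initial energies as jumps, this bounds f by the function [surplus],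
   computed from left to right. The mirror image bounds -f from the right. Both
   bounds have to be compatible in some gap between consecutive agents of
   [lo, hi], and then also in a gap where both of them are nonnegative.
     Conversely, at such a gap the bounds are attained by a schedule in which lo
   and hi themselves walk towards each other: the agents beyond them push their
   energy inwards, the debts (negative surpluses) are paid backwards by the next
   agents, and the token lo (or hi) then collects the energy on its way. Only the
   meeting of lo and hi matters, so the direction of the delivery does not. *)

(** * Net energy flux across a point *)

Lemma dist_ge (R : realType) (x y : R) : x <= y -> `|y - x| = y - x.
Proof. by move=> xy; rewrite ger0_norm // subr_ge0. Qed.

Lemma dist_le (R : realType) (x y : R) : y <= x -> `|y - x| = x - y.
Proof. by move=> xy; rewrite distrC dist_ge. Qed.

Section Flux.
Variables (R : realType) (n : nat).
Implicit Types (c : config R n) (s : seq (action R 'I_n)) (P : pred R).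

Definition nonneg_energy c := forall k, 0 <= energy c k.

Definition distance_right (x : R) c (act : action R 'I_n) : R :=
  match act with
  | Move i y => `|Num.max x y - Num.max x (pos c i)|
  | Transfer _ _ _ => 0
  end.

Fixpoint travel_right (x : R) c s : R :=
  if s is act :: s' then
    distance_right x c act + travel_right x (perform c act) s'
  else 0.

Definition held P c : R := \sum_(k | P (pos c k)) energy c k.

(* With P the half-line to the right of x, the net energy carried across x. *)
Definition flux P (x : R) c s : R :=
  held P (run c s) - held P c + travel_right x c s.

(** The flux jumps at a point where energy lies: [flux_gt] is its value just to the right of [x],
    [flux_ge] its value just to the left. *)
Definition flux_gt x c s := flux (fun y => x < y) x c s.
Definition flux_ge x c s := flux (fun y => x <= y) x c s.

Lemma flux_cons P x c act s :
  flux P x c (act :: s)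
  = held P (perform c act) - held P c + distance_right x c act
    + flux P x (perform c act) s.
Proof. by rewrite /flux /=; ring. Qed.

Lemma perform_nonneg c act :
  nonneg_energy c -> legal c act -> nonneg_energy (perform c act).
Proof.
move=> c0; case: act => [i x|i j w] /=.
  by move=> ix k /=; case: eqP => // _; rewrite subr_ge0.
case/and4P=> _ _ w0 wi k /=; case: eqP => [_|_]; first by rewrite subr_ge0.
by case: eqP => // _; apply: addr_ge0.
Qed.

Lemma run_nonneg c s :
  nonneg_energy c -> feasible c s -> nonneg_energy (run c s).
Proof.
elim: s c => //= act s IHs c c0 /andP[act_ok s_ok].
exact: IHs (perform_nonneg c0 act_ok) s_ok.
Qed.

Lemma held_move P c i y :
  held P (perform c (Move i y)) =
  held P c - (if P (pos c i) then energy c i else 0)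
    + (if P y then energy c i - `|y - pos c i| else 0).
Proof.
rewrite /held big_mkcond [in RHS]big_mkcond /= (bigD1 i) //= [in RHS](bigD1 i) //=.
rewrite eqxx [X in _ + X = _](_ : _ = \sum_(k | k != i)
  (if P (pos c k) then energy c k else 0)); first by ring.
by apply: eq_bigr => k /negPf ->.
Qed.

Lemma held_transfer P c i j w :
  legal c (Transfer i j w) -> held P (perform c (Transfer i j w)) = held P c.
Proof.
case/and4P=> ij /eqP pij _ _; have ji : j != i by rewrite eq_sym.
rewrite /held big_mkcond [in RHS]big_mkcond /=.
rewrite (bigD1 i) // (bigD1 j) //= [in RHS](bigD1 i) // [in RHS](bigD1 j) //=.
rewrite eqxx (negPf ji) eqxx pij !addrA; congr (_ + _).
  by case: ifP => _; ring.
by apply: eq_bigr => k /andP[/negPf -> /negPf ->].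
Qed.

Section Thin.
Variables z1 z2 : R.
Hypothesis lt_z12 : z1 < z2.

Definition outside (y : R) := (y <= z1) || (z2 <= y).

Definition targets s : seq R := pmap (fun act : action R 'I_n =>
  if act is Move _ y then Some y else None) s.

(** Makes the open interval atomic: a move either crosses all of it or does not enter it, so
    crossings can be read off the end points of the moves. *)
Definition avoids c s :=
  (forall k, outside (pos c k)) /\ all outside (targets s).

Lemma avoids_cons c act s : avoids c (act :: s) -> avoids (perform c act) s.
Proof.
case: act => [i y|i j w] [/= ok_c ok_s]; last by split.
by case/andP: ok_s => ok_y ok_s; split=> //= k; case: eqP.
Qed.

Definition crosses_right c (act : action R 'I_n) : bool :=
  if act is Move i y then (pos c i <= z1) && (z2 <= y) else false.
Definition crosses_left c (act : action R 'I_n) : bool :=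
  if act is Move i y then (z2 <= pos c i) && (y <= z1) else false.

Fixpoint crossed_right c s : bool :=
  if s is act :: s' then crosses_right c act || crossed_right (perform c act) s'
  else false.
Fixpoint crossed_left c s : bool :=
  if s is act :: s' then crosses_left c act || crossed_left (perform c act) s'
  else false.

(** Each crossing burns [z2 - z1] inside the interval, and each direction that occurs counts at
    least once. Without a leftward crossing energy only enters the right half-line, without a
    rightward one it only leaves it; hence the two signs. *)
Lemma flux_thin c s : feasible c s -> avoids c s ->
  [/\ flux_ge z2 c s + (crossed_right c s + crossed_left c s)%:R * (z2 - z1)
      <= flux_gt z1 c s,
      ~~ crossed_left c s -> 0 <= flux_ge z2 c s
    & ~~ crossed_right c s -> flux_gt z1 c s <= 0].
Proof.
have lt12 := lt_z12; rewrite /flux_ge /flux_gt; elim: s c => [|act s IHs] c.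
  by move=> _ _; rewrite /flux /= !subrr !add0r mul0r.
rewrite !flux_cons /= => /andP[ok_act ok_s] av.
have [IH1 IH2 IH3] := IHs _ ok_s (avoids_cons av).
move: IH1 IH2 IH3.
set F2 := flux _ _ _ _; set F1 := flux _ _ _ _.
set r := crossed_right _ _; set l := crossed_left _ _.
case: act ok_act av {ok_s} @F1 @F2 @r @l => [i y|i j w] ok_act av F1 F2 r l.
  rewrite !held_move /=.
  have oi : outside (pos c i) by case: av.
  have oy : outside y by case: av => _ /= /andP[].
  rewrite /= in ok_act.
  move: oi oy ok_act {av}; rewrite /outside.
  move: (pos c i) (energy c i) F1 F2 r l => u e F1 F2 r l.
  move=> oi oy ok_act.
  have {}oi : ~~ (u <= z1) -> z2 <= u by case/orP: oi => [->|].
  have {}oy : ~~ (y <= z1) -> z2 <= y by case/orP: oy => [->|].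
  have far v : v <= z1 -> (z2 <= v) = false.
    by move=> vz; apply/negbTE; rewrite -ltNge; apply: le_lt_trans lt_z12.
  have mx1 v : v <= z1 -> Num.max z1 v = z1 by exact: max_l.
  have mx2 v : v <= z1 -> Num.max z2 v = z2.
    by move=> vz; apply/max_l/ltW/(le_lt_trans vz).
  have mx3 v : z2 <= v -> Num.max z2 v = v by exact: max_r.
  have mx4 v : z2 <= v -> Num.max z1 v = v.
    by move=> vz; apply/max_r/ltW/(lt_le_trans _ vz).
  rewrite !ltNge; case: (boolP (u <= z1)) oi => [u1 _|u1 /(_ isT) u2];
    case: (boolP (y <= z1)) oy => [y1 _|y1 /(_ isT) y2].
  - rewrite (far u u1) (far y y1) (mx1 u u1) (mx1 y y1) (mx2 u u1) (mx2 y y1) /=.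
    rewrite !subrr !normr0 => h1 h2 h3.
    by split; [lra|move=> /h2; lra|move=> /h3; lra].
  - rewrite (far u u1) y2 (mx3 y y2) (mx4 y y2) (mx2 u u1) (mx1 u u1) /=.
    have e1 : `|y - u| = y - u by apply: dist_ge; lra.
    have e2 : `|y - z2| = y - z2 by apply: dist_ge; lra.
    have e3 : `|y - z1| = y - z1 by apply: dist_ge; lra.
    rewrite e1 in ok_act; rewrite e1 e2 e3 => h1 h2 h3.
    split; [|by move=> /h2; lra|by []].
    move: h1; case: (r); case: (l); rewrite !natrD /=; lra.
  - rewrite u2 (far y y1) (mx3 u u2) (mx4 u u2) (mx2 y y1) (mx1 y y1) /= ?orbF.
    have e1 : `|y - u| = u - y by apply: dist_le; lra.
    have e2 : `|z2 - u| = u - z2 by apply: dist_le; lra.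
    have e3 : `|z1 - u| = u - z1 by apply: dist_le; lra.
    rewrite e1 in ok_act; rewrite e2 e3 => h1 h2 h3.
    split; [|by []|by move=> /h3; lra].
    move: h1; case: (r); case: (l); rewrite !natrD /=; lra.
  - rewrite u2 y2 (mx3 u u2) (mx3 y y2) (mx4 u u2) (mx4 y y2) /=.
    move=> h1 h2 h3.
    by split; [lra|move=> /h2; lra|move=> /h3; lra].
rewrite !held_transfer //= => h1 h2 h3.
by split; [lra|move=> /h2; lra|move=> /h3; lra].
Qed.

End Thin.
End Flux.

(** * Tokens crossing an interval *)

Section Tokens.
Variables (R : realType) (n : nat).
Implicit Types (c : config R n) (s : seq (action R 'I_n)).
Implicit Types T : config R n -> pred 'I_n.

(* A token is a mark borne by agents which travels only along trajectories:
   either the identity of a fixed agent or the possession of an information. *)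
Definition conveyed T := forall c act k, T (perform c act) k ->
  exists2 j, T c j & pos c j = pos (perform c act) k \/
    exists i y, [/\ act = Move i y,
      between (pos c i) (pos c j) (pos (perform c act) k)
    & between (pos c i) (pos (perform c act) k) y].

Lemma conveyed_agent q : conveyed (fun _ k => k == q).
Proof.
move=> c act k /eqP->; exists q => //.
case: act => [i y|i j w] /=; last by left.
case: (eqVneq q i) => [->|_]; last by left.
by right; exists i, y; split=> //; rewrite /between !lexx ?andbT;
  apply: le_total.
Qed.

Lemma conveyed_info p : conveyed (fun c k => p \in info c k).
Proof.
move=> c [i y|i j w] k /=; last by exists k => //; left.
case: ifP => [b1|nb] pk; last first.
  exists k => //; case: eqP nb => [->|_ _]; last by left.
  by rewrite /between !lexx !andbT le_total.
have /bigcupP[j b2 pj] := pk; exists j => //.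
by right; exists i, y; split.
Qed.

Section Crossing.
Variables (z1 z2 : R).
Hypothesis lt_z12 : z1 < z2.

(** As long as no move crosses rightwards, all tokens stay on the left: a token reaching the right
    side must follow a trajectory, which then crosses the interval. *)
Lemma token_crosses_right T c s : conveyed T -> avoids z1 z2 c s ->
    (forall k, T c k -> pos c k <= z1) ->
    (exists2 k, T (run c s) k & z2 <= pos (run c s) k) ->
  crossed_right z1 z2 c s.
Proof.
move=> cT; have lt12 := lt_z12.
elim: s c => [|act s IHs] c av Tc /= Tr.
  have [k Tk zk] := Tr; have := le_trans zk (Tc _ Tk).
  by rewrite leNgt lt_z12.
have av' := avoids_cons av; case: (boolP (crosses_right _ _ _ _)) => //= ncr.
apply: IHs => // k /cT[j Tj []]; first by move=> <-; apply: Tc.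
move=> [i [y [eq_act b1 b2]]]; have pj := Tc _ Tj.
have := av'.1 k; case/orP=> // zk.
move: b1 b2 ncr zk; rewrite eq_act /=; set x := (if _ then _ else _).
move=> b1 b2 ncr zk; case/negP: ncr.
have oi : (pos c i <= z1) || (z2 <= pos c i) := av.1 i.
case/orP: oi => ui; last by case/orP: b1 => /andP[? ?]; exfalso; lra.
rewrite ui /=; case/orP: b2 => /andP[? ?]; first lra.
by exfalso; lra.
Qed.

Lemma token_crosses_left T c s : conveyed T -> avoids z1 z2 c s ->
    (forall k, T c k -> z2 <= pos c k) ->
    (exists2 k, T (run c s) k & pos (run c s) k <= z1) ->
  crossed_left z1 z2 c s.
Proof.
move=> cT; have lt12 := lt_z12.
elim: s c => [|act s IHs] c av Tc /= Tr.
  have [k Tk zk] := Tr; have := le_trans (Tc _ Tk) zk.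
  by rewrite leNgt lt_z12.
have av' := avoids_cons av; case: (boolP (crosses_left _ _ _ _)) => //= ncr.
apply: IHs => // k /cT[j Tj []]; first by move=> <-; apply: Tc.
move=> [i [y [eq_act b1 b2]]]; have pj := Tc _ Tj.
have := av'.1 k; case/orP=> // zk.
move: b1 b2 ncr zk; rewrite eq_act /=; set x := (if _ then _ else _).
move=> b1 b2 ncr zk; case/negP: ncr.
have oi : (pos c i <= z1) || (z2 <= pos c i) := av.1 i.
case/orP: oi => ui; first by case/orP: b1 => /andP[? ?]; exfalso; lra.
rewrite ui /=; case/orP: b2 => /andP[? ?]; last lra.
by exfalso; lra.
Qed.

End Crossing.

(** The jump of the flux at [x] is the initial energy there minus the final one, and the latter is
    nonnegative. *)
Lemma flux_gt_le x c s : nonneg_energy c -> feasible c s ->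
  flux_gt x c s <= flux_ge x c s + \sum_(k | pos c k == x) energy c k.
Proof.
move=> c0 ok; have held_split c' : held (fun y => x <= y) c' =
    held (fun y => x < y) c' + \sum_(k | pos c' k == x) energy c' k.
  rewrite /held big_mkcond [X in _ = X + _]big_mkcond.
  rewrite [X in _ = _ + X]big_mkcond -big_split; apply: eq_bigr => k _ /=.
  by rewrite eq_sym; case: ltgtP => _; rewrite ?addr0 ?add0r.
rewrite /flux_gt /flux_ge /flux !held_split.
have : 0 <= \sum_(k | pos (run c s) k == x) energy (run c s) k.
  by apply: sumr_ge0 => k _; apply: run_nonneg.
lra.
Qed.

(* By conservation of energy. *)
Lemma flux_ge_le0 x c s : nonneg_energy c -> feasible c s ->
  (forall k, x <= pos c k) -> flux_ge x c s <= 0.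
Proof.
move=> c0 ok cx.
have -> : flux_ge x c s
    = held (fun y => x <= y) (run c s) - held predT c + travel_right x c s.
  rewrite /flux_ge /flux; congr (_ - _ + _); apply: eq_bigl => k.
  by rewrite cx.
have hl : held (fun y => x <= y) (run c s) <= held predT (run c s).
  rewrite /held [X in X <= _]big_mkcond; apply: ler_sum => k _.
  by case: ifP => _ //; apply: run_nonneg.
suff : held predT (run c s) + travel_right x c s <= held predT c by lra.
elim: s c {c0 cx hl} ok => [|act s IHs] c /=; first by rewrite addr0.
case/andP=> ok_act /IHs {IHs}.
suff : held predT (perform c act) + distance_right x c act <= held predT c by lra.
case: act ok_act => [i y|i j w] ok_act; last by rewrite held_transfer //= addr0.
rewrite held_move /=.
suff : `|Num.max x y - Num.max x (pos c i)| <= `|y - pos c i| by lra.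
move: (pos c i) => u.
have [ux|/ltW ux] := leP u x; have [yx|/ltW yx] := leP y x.
- by rewrite subrr normr0.
- by rewrite !dist_ge //; lra.
- by rewrite !dist_le //; lra.
- by [].
Qed.

Lemma flux_gt_ge0 x c s : nonneg_energy c -> feasible c s ->
  (forall k, pos c k <= x) -> 0 <= flux_gt x c s.
Proof.
move=> c0 ok cx; rewrite /flux_gt /flux.
have -> : held (fun y => x < y) c = 0.
  by apply: big1 => k; rewrite ltNge cx.
rewrite subr0 addr_ge0 //; first by apply: sumr_ge0 => k _; apply: run_nonneg.
elim: s c {c0 ok cx} => //= act s IHs c; rewrite addr_ge0 //.
by case: act => [i y|i j w] //=; apply: normr_ge0.
Qed.

(** The interval is cut at the move targets inside it, which leaves pieces avoided by [s]. No agent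
    starts inside, so the flux does not increase at a cut; this is the [g' <= g] in the
    concatenation property of [Q]. *)
Lemma flux_interval (Q : R -> R -> R -> Prop) c s x1 x2 :
    x1 < x2 -> nonneg_energy c -> feasible c s ->
    (forall k, outside x1 x2 (pos c k)) ->
    (forall d1 d2 f g g' h, 0 < d1 -> 0 < d2 ->
      Q d1 f g -> g' <= g -> Q d2 g' h -> Q (d1 + d2) f h) ->
    (forall z1 z2, x1 <= z1 -> z1 < z2 -> z2 <= x2 -> avoids z1 z2 c s ->
      Q (z2 - z1) (flux_gt z1 c s) (flux_ge z2 c s)) ->
  Q (x2 - x1) (flux_gt x1 c s) (flux_ge x2 c s).
Proof.
move=> x12 c0 ok out Qtrans Qthin.
(* [L] contains the targets that still lie inside the current interval; every cut removes one
   entry. *)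
have: forall y, y \in targets s -> x1 < y < x2 -> y \in targets s by [].
move: {-1}(targets s) => L.
elim: L x1 x2 x12 out Qthin => [|z L IHL] x1 x2 x12 out Qthin inL.
  apply: Qthin => //; split=> //; apply/allP => y ys.
  by apply/negPn/negP; rewrite negb_or -!ltNge => /(inL y ys).
have [/andP[x1z zx2]|zx] := boolP (x1 < z < x2); last first.
  apply: IHL => // y ys yx; have := inL y ys yx.
  by rewrite inE => /orP[/eqP yz|//]; rewrite -yz yx in zx.
have -> : x2 - x1 = (z - x1) + (x2 - z) by ring.
have inL' y : y \in targets s -> x1 < y < x2 -> y != z -> y \in L.
  by move=> ys yx yz; have := inL y ys yx; rewrite inE (negPf yz).
apply: (Qtrans _ _ _ (flux_ge z c s) (flux_gt z c s)); rewrite ?subr_gt0 //.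
- apply: IHL => //.
  + move=> k; have := out k; rewrite /outside => /orP[->//|h].
    by apply/orP; right; lra.
  + by move=> z1 z2 h1 h2 h3; apply: Qthin => //; lra.
  + move=> y ys /andP[y1 y2]; apply: inL' => //; last by rewrite lt_eqF.
    by rewrite y1; lra.
- have := flux_gt_le z c0 ok; rewrite big1 ?addr0 // => k /eqP kz.
  by have := out k; rewrite /outside kz leNgt x1z /= leNgt zx2.
- apply: IHL => //.
  + move=> k; have := out k; rewrite /outside => /orP[h|->]; rewrite ?orbT //.
    by apply/orP; left; lra.
  + by move=> z1 z2 h1 h2 h3; apply: Qthin => //; lra.
  + move=> y ys /andP[y1 y2]; apply: inL' => //; last by rewrite gt_eqF.
    by rewrite y2 andbT; lra.
Qed.

End Tokens.

(** * Upper bounds on the flux *)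

Section Surplus.
Variable R : realType.
Implicit Types (A E : nat -> R) (v d : R) (free : bool).

(* A negative v stands for a debt. Moving the token over a distance d costs d as
   long as there is energy at hand and 2 d beyond, since the missing energy has
   to be brought from the other end; when no token has to be moved (free), the
   missing energy is not worth being brought. *)
Definition transport free v d : R :=
  if d <= v then v - d else
  if free then 0 else
  if 0 <= v then 2 * (v - d) else v - 2 * d.

(** Bounds the flux just to the right of agent [k]. The gap after agent [k'] is free exactly when it
    lies before the token [lo]. *)
Fixpoint surplus A E (lo k : nat) : R :=
  if k is k'.+1 then
    E k + transport (k' < lo)%N (surplus A E lo k') (A k - A k')
  else E 0%N.

Lemma transport_mono free v v' d :
  0 <= d -> v <= v' -> transport free v d <= transport free v' d.
Proof.
rewrite /transport => d0 vv'.
case: free; repeat match goal with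
  | |- context [if ?u <= ?v then _ else _] => case: (leP u v) => ? end; lra.
Qed.

(** The semigroup law needed to concatenate bounds over consecutive pieces of an interval. *)
Lemma transport_add free v d1 d2 : 0 < d1 -> 0 < d2 ->
  transport free (transport free v d1) d2 = transport free v (d1 + d2).
Proof.
rewrite /transport => d10 d20.
case: (leP d1 v) => h1; case: (leP (d1 + d2) v) => h2; case: (leP 0 v) => h3;
  case: free;
  repeat match goal with
  | |- context [if ?u <= ?v then _ else _] => case: (leP u v) => ? end; lra.
Qed.

Lemma transport_le v d : 0 <= d -> transport false v d <= v - d.
Proof.
rewrite /transport => d0; case: (leP d v); case: (leP 0 v) => *; lra.
Qed.

Lemma transport_free_ge0 v d : 0 <= transport true v d.
Proof. by rewrite /transport; case: (leP d v) => h; lra. Qed.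

(** Turns [flux_thin] into transport bounds, for [f] read rightwards and [- f] read leftwards. With
    both directions crossed the flux drops by [2 * d]; with the rightward one alone it drops by [d]
    but ends nonnegative. Both outcomes satisfy the bound of slope 1 above zero and slope 2
    below. *)
Lemma transport_crossed (rc lc : bool) f h d : 0 < d ->
    h + (rc + lc)%:R * d <= f -> (~~ lc -> 0 <= h) -> (~~ rc -> f <= 0) ->
  [/\ h <= transport true f d, - f <= transport true (- h) d,
      rc -> h <= transport false f d, lc -> - f <= transport false (- h) d
    & rc || lc -> h <= f - d].
Proof.
rewrite /transport => d0 h1 h2 h3; move: h1 h2 h3.
case: rc; case: lc; rewrite natrD /= => h1 h2 h3;
  try (have {}h2 := h2 isT); try (have {}h3 := h3 isT);
  split=> //; try (move=> _);
  repeat match goal with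
  | |- context [if ?u <= ?v then _ else _] => case: (leP u v) => ? end; lra.
Qed.

Section Interval.
Variables (n : nat) (c : config R n) (s : seq (action R 'I_n)) (x1 x2 : R).
Hypotheses (x12 : x1 < x2) (c0 : nonneg_energy c) (ok : feasible c s).
Hypothesis out : forall k, outside x1 x2 (pos c k).

Lemma flux_free_right :
  flux_ge x2 c s <= transport true (flux_gt x1 c s) (x2 - x1).
Proof.
apply: (flux_interval (Q := fun d f h => h <= transport true f d)) => //.
  move=> d1 d2 f g g' h d10 d20 hg gg' hh; rewrite -transport_add //.
  by apply: le_trans hh _; apply: transport_mono; lra.
move=> z1 z2 _ z12 _ av; have [h1 h2 h3] := flux_thin z12 ok av.
by have [] := transport_crossed _ h1 h2 h3; rewrite ?subr_gt0.
Qed.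

Lemma flux_free_left :
  - flux_gt x1 c s <= transport true (- flux_ge x2 c s) (x2 - x1).
Proof.
apply: (flux_interval (Q := fun d f h => - f <= transport true (- h) d)) => //.
  move=> d1 d2 f g g' h d10 d20 hg gg' hh; rewrite addrC -transport_add //.
  by apply: le_trans hg _; apply: transport_mono; lra.
move=> z1 z2 _ z12 _ av; have [h1 h2 h3] := flux_thin z12 ok av.
by have [] := transport_crossed _ h1 h2 h3; rewrite ?subr_gt0.
Qed.

Lemma flux_crossed_right :
    (forall z1 z2, x1 <= z1 -> z1 < z2 -> z2 <= x2 -> avoids z1 z2 c s ->
      crossed_right z1 z2 c s) ->
  flux_ge x2 c s <= transport false (flux_gt x1 c s) (x2 - x1).
Proof.
move=> cr.
apply: (flux_interval (Q := fun d f h => h <= transport false f d)) => //.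
  move=> d1 d2 f g g' h d10 d20 hg gg' hh; rewrite -transport_add //.
  by apply: le_trans hh _; apply: transport_mono; lra.
move=> z1 z2 ? z12 ? av; have [h1 h2 h3] := flux_thin z12 ok av.
have [|_ _ hr _ _] := transport_crossed _ h1 h2 h3; rewrite ?subr_gt0 //.
by apply: hr; apply: cr.
Qed.

Lemma flux_crossed_left :
    (forall z1 z2, x1 <= z1 -> z1 < z2 -> z2 <= x2 -> avoids z1 z2 c s ->
      crossed_left z1 z2 c s) ->
  - flux_gt x1 c s <= transport false (- flux_ge x2 c s) (x2 - x1).
Proof.
move=> cl.
apply: (flux_interval (Q := fun d f h => - f <= transport false (- h) d)) => //.
  move=> d1 d2 f g g' h d10 d20 hg gg' hh; rewrite addrC -transport_add //.
  by apply: le_trans hg _; apply: transport_mono; lra.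
move=> z1 z2 ? z12 ? av; have [h1 h2 h3] := flux_thin z12 ok av.
have [|_ _ _ hl _] := transport_crossed _ h1 h2 h3; rewrite ?subr_gt0 //.
by apply: hl; apply: cl.
Qed.

(** Meant for the gap where the tokens meet: its points may be crossed in either direction, so only
    the rate 1 is available. *)
Lemma flux_crossed :
    (forall z1 z2, x1 <= z1 -> z1 < z2 -> z2 <= x2 -> avoids z1 z2 c s ->
      crossed_right z1 z2 c s || crossed_left z1 z2 c s) ->
  flux_ge x2 c s <= flux_gt x1 c s - (x2 - x1).
Proof.
move=> cr.
apply: (flux_interval (Q := fun d f h => h <= f - d)) => //.
  by move=> d1 d2 f g g' h d10 d20 hg gg' hh; lra.
move=> z1 z2 ? z12 ? av; have [h1 h2 h3] := flux_thin z12 ok av.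
have [|_ _ _ _ hm] := transport_crossed _ h1 h2 h3; rewrite ?subr_gt0 //.
by apply: hm; apply: cr.
Qed.
End Interval.

End Surplus.

(** * Bounding the flux of a delivering schedule from both ends *)

Section Necessity.
Variables (R : realType) (n : nat) (a e : 'I_n -> R).
Hypothesis a_mono : forall i j : 'I_n, (i < j)%N -> a i < a j.
Hypothesis e_ge0 : forall i : 'I_n, 0 <= e i.

Definition extend (f : 'I_n -> R) (k : nat) : R := oapp f 0 (insub k).

(** Counting from the right end and negating the points keeps the positions increasing, so the bound
    on [- f] from the right is again a [surplus]. *)
Definition mirror (A : nat -> R) (k : nat) : R := - A (n.-1 - k)%N.
Definition reversal (E : nat -> R) (k : nat) : R := E (n.-1 - k)%N.

Local Notation A := (extend a).
Local Notation E := (extend e).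
Local Notation A' := (mirror A).
Local Notation E' := (reversal E).
Local Notation c0 := (init_config a e).

Lemma init_nonneg : nonneg_energy c0. Proof. exact: e_ge0. Qed.
Local Hint Resolve init_nonneg : core.

Lemma extendE f (k : 'I_n) : extend f k = f k.
Proof. by rewrite /extend valK. Qed.

Lemma extend_ltn i j : (i < j)%N -> (j < n)%N -> A i < A j.
Proof.
move=> ij jn; have iN := ltn_trans ij jn.
by rewrite -[i]/(val (Ordinal iN)) -[j]/(val (Ordinal jn)) !extendE; apply: a_mono.
Qed.

Lemma extend_leq i j : (i <= j)%N -> (j < n)%N -> A i <= A j.
Proof.
by rewrite leq_eqVlt => /predU1P[->//|ij jn]; apply/ltW/extend_ltn.
Qed.

Lemma gap_outside j : (j.+1 < n)%N -> forall k, outside (A j) (A j.+1) (pos c0 k).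
Proof.
move=> jn k; rewrite /outside /= -extendE.
have [kj|jk] := leqP k j; apply/orP; [left | right]; apply: extend_leq => //.
exact: ltnW.
Qed.

Lemma flux_gt_agent s k : feasible c0 s -> (k < n)%N ->
  flux_gt (A k) c0 s <= flux_ge (A k) c0 s + E k.
Proof.
move=> ok kn; apply: le_trans (flux_gt_le (A k) init_nonneg ok) _.
rewrite lerD2l -[k]/(val (Ordinal kn)) !extendE /= (big_pred1 (Ordinal kn)) // => j.
rewrite /=; apply/eqP/eqP => [aj|-> //]; apply/val_inj/eqP; apply: contraT.
by rewrite neq_ltn => /orP[] /a_mono; rewrite aj ltxx.
Qed.

(** The point [y] is where the delivery takes place: left of it the line is crossed rightwards from
    [lo] on, right of it leftwards from [hi] on. The two surplus bounds are propagated up to the gap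
    containing [y] and compared across it. *)
Lemma crossing_necessary s (lo hi : 'I_n) (y : R) : feasible c0 s -> (lo < hi)%N ->
    (forall z1 z2, a lo <= z1 -> z1 < z2 -> z2 <= a hi -> avoids z1 z2 c0 s ->
      [/\ outside z1 z2 y, z2 <= y -> crossed_right z1 z2 c0 s
        & y <= z1 -> crossed_left z1 z2 c0 s]) ->
  exists i, [/\ (lo <= i)%N, (i < hi)%N &
    A i.+1 - A i <= surplus A E lo i + surplus A' E' (n.-1 - hi) (n.-1 - i.+1)].
Proof.
move=> ok lohi cross; have hin := ltn_ord hi.
(* The gap after [i] will contain [y] clipped to the interval from [lo] to [hi]: [i] is the last
   agent before [hi] that is not beyond [y], or [lo] itself. *)
pose P i := [&& (lo <= i)%N, (i < hi)%N & (i == lo :> nat) || (A i <= y)].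
have exP : exists i, P i by exists lo; rewrite /P leqnn lohi eqxx.
have ubP i : P i -> (i <= hi)%N by case/and3P=> _ /ltnW.
case: (ex_maxnP exP ubP) => i /and3P[loi ihi yi] imax.
exists i; split=> //.
have above j : (i < j)%N -> (j < hi)%N -> y <= A j.
  move=> ij jhi; rewrite leNgt; apply/negP => /ltW Aj.
  have := imax j; rewrite /P jhi Aj orbT (leq_trans loi (ltnW ij)) => /(_ isT).
  by rewrite leqNgt ij.
have below j : (lo <= j)%N -> (j < i)%N -> A j.+1 <= y.
  move=> loj ji; case/orP: yi => [/eqP ilo|]; first by rewrite ilo ltnNge loj in ji.
  by apply: le_trans; apply: extend_leq => //; apply: ltn_trans hin.
have left_bound k : (k <= i)%N -> flux_gt (A k) c0 s <= surplus A E lo k.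
  elim: k => [|k IHk] ki.
    have n0 : (0 < n)%N by apply: leq_trans hin.
    have := flux_gt_agent ok n0; have : flux_ge (A 0%N) c0 s <= 0.
      by apply: flux_ge_le0 => // j /=; rewrite -extendE extend_leq.
    by rewrite /=; lra.
  have kn : (k.+1 < n)%N by lia.
  have Ak : A k < A k.+1 by apply: extend_ltn.
  have {}IHk := IHk (ltnW ki).
  suff : flux_ge (A k.+1) c0 s
      <= transport (k < lo)%N (flux_gt (A k) c0 s) (A k.+1 - A k).
    have := flux_gt_agent ok kn.
    have : transport (k < lo)%N (flux_gt (A k) c0 s) (A k.+1 - A k) <=
        transport (k < lo)%N (surplus A E lo k) (A k.+1 - A k).
      by apply: transport_mono => //; lra.
    by rewrite /=; lra.
  case: ltnP => klo; first by apply: flux_free_right => //; apply: gap_outside.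
  apply: flux_crossed_right => //; first exact: gap_outside.
  move=> z1 z2 z1k z12 z2k av; have [||_ cr _] := cross z1 z2 _ z12 _ av; last apply: cr.
  - by rewrite -extendE (le_trans _ z1k) // extend_leq // ltnW.
  - rewrite -extendE (le_trans z2k) // extend_leq //.
    exact: ltnW (leq_ltn_trans ki ihi).
  - exact: le_trans z2k (below _ klo ki).
have right_bound m : (m <= n.-1 - i.+1)%N ->
    - flux_ge (A (n.-1 - m)%N) c0 s <= surplus A' E' (n.-1 - hi) m.
  have n0 : (0 < n)%N by apply: leq_trans hin.
  elim: m => [|m IHm] mi.
    have n1 : (n.-1 < n)%N by rewrite prednK.
    have := flux_gt_agent ok n1; have : 0 <= flux_gt (A n.-1) c0 s.
      apply: flux_gt_ge0 => // j /=; rewrite -extendE extend_leq //.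
      by rewrite -ltnS prednK.
    by rewrite /= /reversal subn0; lra.
  have {}IHm := IHm (ltnW mi).
  set j := (n.-1 - m.+1)%N.
  have eqj : (n.-1 - m = j.+1)%N by rewrite /j; lia.
  have jn : (j.+1 < n)%N by rewrite /j; lia.
  have ij : (i < j)%N by rewrite /j; lia.
  have Aj : A j < A j.+1 by apply: extend_ltn.
  rewrite eqj in IHm.
  suff : - flux_gt (A j) c0 s
      <= transport (hi <= j)%N (- flux_ge (A j.+1) c0 s) (A j.+1 - A j).
    have := flux_gt_agent ok (ltnW jn).
    have : transport (hi <= j)%N (- flux_ge (A j.+1) c0 s) (A j.+1 - A j) <=
        transport (hi <= j)%N (surplus A' E' (n.-1 - hi) m) (A j.+1 - A j).
      by apply: transport_mono => //; lra.
    rewrite /= /mirror /reversal -/j eqj.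
    have -> : (m < n.-1 - hi)%N = (hi <= j)%N by rewrite /j; lia.
    have -> : - A j - - A j.+1 = A j.+1 - A j by ring.
    by lra.
  case: leqP => jhi; first by apply: flux_free_left => //; apply: gap_outside.
  apply: flux_crossed_left => //; first exact: gap_outside.
  move=> z1 z2 z1j z12 z2j av; have [||_ _ cl] := cross z1 z2 _ z12 _ av; last apply: cl.
  - rewrite -extendE (le_trans _ z1j) // extend_leq // ?(leq_trans loi) //; lia.
  - by rewrite -extendE (le_trans z2j) // extend_leq.
  - exact: le_trans (above _ ij jhi) z1j.
have i1n : (i.+1 < n)%N by apply: leq_ltn_trans hin.
have Ai : A i < A i.+1 by apply: extend_ltn.
have := left_bound i (leqnn _); have := right_bound _ (leqnn _).
have -> : (n.-1 - (n.-1 - i.+1) = i.+1)%N by lia.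
(* The left bound controls the flux at the beginning of the gap, the right bound controls its
   opposite at the end; the drop across the gap links them. *)
suff : flux_ge (A i.+1) c0 s <= flux_gt (A i) c0 s - (A i.+1 - A i) by lra.
apply: flux_crossed => //; first exact: gap_outside.
move=> z1 z2 z1i z12 z2i av.
have [||oy cr cl] := cross z1 z2 _ z12 _ av.
- by rewrite -extendE (le_trans _ z1i) // extend_leq // ltnW.
- by rewrite -extendE (le_trans z2i) // extend_leq.
by case/orP: oy => [/cl|/cr] ->; rewrite ?orbT.
Qed.
End Necessity.

(** * Necessary condition *)

Section Runs.
Variables (R : realType) (n : nat).
Implicit Types (c : config R n) (s : seq (action R 'I_n)).

Lemma run_cat c s1 s2 : run c (s1 ++ s2) = run (run c s1) s2.
Proof. exact: foldl_cat. Qed.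

Lemma feasible_cat c s1 s2 :
  feasible c (s1 ++ s2) = feasible c s1 && feasible (run c s1) s2.
Proof. by elim: s1 c => //= act s1 IHs c; rewrite IHs andbA. Qed.

Lemma avoids_run z1 z2 c s : avoids z1 z2 c s ->
  forall k, outside z1 z2 (pos (run c s) k).
Proof.
elim: s c => [|act s IHs] c av; first exact: av.1.
exact: IHs (avoids_cons av).
Qed.

Lemma info_perform c act k : info c k \subset info (perform c act) k.
Proof.
case: act => [i y|i j w] //=; case: ifP => // _.
apply: (bigcup_max k) => //; case: eqP => [->|_]; rewrite /between !lexx ?andbT //=.
  exact: le_total.
exact: le_total.
Qed.

Lemma info_run c s k : info c k \subset info (run c s) k.
Proof.
elim: s c => //= act s IHs c.
exact: subset_trans (info_perform c act k) (IHs _).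
Qed.

End Runs.

(** * Reduction to a gap where both surpluses are nonnegative *)

Section Balance.
Variables (R : realType) (n : nat) (a e : 'I_n -> R).
Hypothesis a_mono : forall i j : 'I_n, (i < j)%N -> a i < a j.
Hypothesis e_ge0 : forall i : 'I_n, 0 <= e i.

Local Notation A := (extend a).
Local Notation E := (extend e).

Definition left_surplus lo k := surplus A E lo k.
Definition right_surplus hi k :=
  surplus (mirror n A) (reversal n E) (n.-1 - hi) (n.-1 - k).

Definition feasible_gap lo hi i := [&& (lo <= i < hi)%N,
  A i.+1 - A i <= left_surplus lo i + right_surplus hi i.+1,
  0 <= left_surplus lo i & 0 <= right_surplus hi i.+1].

Lemma extend_ge0 k : 0 <= E k.
Proof. by rewrite /extend; case: (insub k) => [i|] /=; rewrite ?e_ge0. Qed.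

Lemma right_surplusE hi k : (k.+1 < n)%N -> right_surplus hi k =
  E k + transport (hi <= k)%N (right_surplus hi k.+1) (A k.+1 - A k).
Proof.
move=> kn; rewrite /right_surplus.
have -> : (n.-1 - k = (n.-1 - k.+1).+1)%N by lia.
rewrite /= /mirror /reversal; congr (_ + transport _ _ _).
- by congr (extend _ _); lia.
- by lia.
- have -> : (n.-1 - (n.-1 - k.+1).+1 = k)%N by lia.
  have -> : (n.-1 - (n.-1 - k.+1) = k.+1)%N by lia.
  by rewrite opprK addrC.
Qed.

Lemma left_surplus_start lo : 0 <= left_surplus lo lo.
Proof.
rewrite /left_surplus; case: lo => [|lo] /=; first exact: extend_ge0.
by rewrite ltnSn addr_ge0 ?extend_ge0 // transport_free_ge0.
Qed.

Lemma right_surplus_start (hi : 'I_n) : 0 <= right_surplus hi hi.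
Proof.
have hin := ltn_ord hi; have [hi1|hi1] := ltnP hi.+1 n.
  by rewrite right_surplusE // leqnn addr_ge0 ?extend_ge0 // transport_free_ge0.
rewrite /right_surplus; have -> : (n.-1 - hi = 0)%N by lia.
exact: extend_ge0.
Qed.

(** If the right surplus is negative, the left one exceeds the length of the gap, so it passes to
    agent [i.+1] losing exactly that length. By [transport_le] the right surplus lost at least the
    length of the next gap, so the balance persists there. The shift ends before [hi], where the
    right surplus is nonnegative. *)
Lemma feasible_gap_exists (lo hi : 'I_n) i : (lo <= i)%N -> (i < hi)%N ->
    A i.+1 - A i <= left_surplus lo i + right_surplus hi i.+1 ->
  exists i, feasible_gap lo hi i.
Proof.
have hin := ltn_ord hi; have Alt := extend_ltn a_mono; have E0 := extend_ge0.
move=> loi ihi bal; have [Vi|Vi] := leP 0 (left_surplus lo i).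
- move eqm : (hi - i)%N => m.
  elim: m i eqm loi ihi bal Vi => [|m IHm] i eqm loi ihi bal Vi; first by lia.
  have [Wi|Wi] := leP 0 (right_surplus hi i.+1).
    by exists i; rewrite /feasible_gap loi ihi bal Vi Wi.
  have i1hi : (i.+1 < hi)%N.
    rewrite ltn_neqAle ihi andbT; apply: contraTneq Wi => ->.
    by rewrite -leNgt right_surplus_start.
  have kn : (i.+2 < n)%N by lia.
  have := Alt i i.+1 (ltnSn _) (ltnW kn); have := Alt i.+1 i.+2 (ltnSn _) kn => A1 A0.
  have nhi : (hi <= i.+1)%N = false by lia.
  have VE : left_surplus lo i.+1 = E i.+1 + (left_surplus lo i - (A i.+1 - A i)).
    rewrite /left_surplus /= ltnNge loi /= {1}/transport.
    by case: leP => // h; move: bal Wi h; rewrite /left_surplus; lra.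
  have := transport_le (right_surplus hi i.+2) (d := A i.+2 - A i.+1).
  have := right_surplusE hi kn; rewrite nhi => WE.
  rewrite subr_ge0 ltW // => /(_ isT) WL.
  have := E0 i.+1 => e0.
  by apply: (IHm i.+1); rewrite ?VE //; [lia|lia|lra|lra].
(* Mirror case: the left surplus is negative, so the right one exceeds the length of the gap, and
   the gap is shifted leftwards towards [lo]. *)
have Wi : 0 <= right_surplus hi i.+1.
  have := Alt i i.+1 (ltnSn _) (leq_ltn_trans ihi hin); lra.
elim: i loi ihi bal Vi Wi => [|i IHi] loi ihi bal Vi Wi.
  have := left_surplus_start lo; have -> : lo = 0%N :> nat by lia.
  by rewrite leNgt Vi.
have loi' : (lo <= i)%N.
  rewrite -ltnS ltn_neqAle loi andbT; apply: contraTneq Vi => <-.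
  by rewrite -leNgt left_surplus_start.
have kn : (i.+2 < n)%N by lia.
have := Alt i i.+1 (ltnSn _) (ltnW kn); have := Alt i.+1 i.+2 (ltnSn _) kn => A1 A0.
have nhi : (hi <= i.+1)%N = false by lia.
have WE : right_surplus hi i.+1
    = E i.+1 + (right_surplus hi i.+2 - (A i.+2 - A i.+1)).
  rewrite right_surplusE // nhi {1}/transport.
  by case: leP => // h; move: bal Vi h; lra.
have := transport_le (left_surplus lo i) (d := A i.+1 - A i).
have VE : left_surplus lo i.+1
    = E i.+1 + transport false (left_surplus lo i) (A i.+1 - A i).
  by rewrite /left_surplus /= ltnNge loi'.
rewrite subr_ge0 ltW // => /(_ isT) VL.
have := E0 i.+1 => e0.
have bal' : A i.+1 - A i <= left_surplus lo i + right_surplus hi i.+1 by lra.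
have Wi' : 0 <= right_surplus hi i.+1 by lra.
have [Vi'|Vi'] := leP 0 (left_surplus lo i); last first.
  by apply: IHi => //; apply: ltnW.
by exists i; rewrite /feasible_gap loi' (ltnW ihi) bal' Vi' Wi'.
Qed.

(** The schedule is cut at the moment of the delivery. Two tokens are then at the position [y] of
    [q]: the information of [p] and the agent [q] itself. One of them started at [lo], the other at
    [hi], which gives the crossings on both sides of [y]. *)
Lemma deliverable_gap (p q lo hi : 'I_n) : p != q ->
    (p < q)%N /\ lo = p /\ hi = q \/ (q < p)%N /\ lo = q /\ hi = p ->
    deliverable a e p q ->
  exists i, feasible_gap lo hi i.
Proof.
move=> pq order [s [ok [k pk]]].
have lohi : (lo < hi)%N by case: order => [[? [-> ->]]|[? [-> ->]]].
move: ok; rewrite -(cat_take_drop k s) feasible_cat => /andP[ok _].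
move: (take k s) ok pk => {}s ok pk {k}.
set c0 := init_config a e in ok pk.
pose y := pos (run c0 s) q.
have [|i [loi ihi bal]] := crossing_necessary a_mono e_ge0 (y := y) ok lohi.
  move=> z1 z2 z1lo z12 z2hi av; split; first exact: avoids_run.
  - move=> zy; case: order => -[lt_pq [loE hiE]].
    + apply: (token_crosses_right z12 (@conveyed_info R n p)) => //.
        by move=> k /=; rewrite inE => /eqP <-; rewrite -loE.
      by exists q.
    + apply: (token_crosses_right z12 (@conveyed_agent R n q)) => //.
        by move=> k /eqP-> /=; rewrite -loE.
      by exists q.
  - move=> zy; case: order => -[lt_pq [loE hiE]].
    + apply: (token_crosses_left z12 (@conveyed_agent R n q)) => //.
        by move=> k /eqP-> /=; rewrite -hiE.
      by exists q.
    + apply: (token_crosses_left z12 (@conveyed_info R n p)) => //.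
        by move=> k /=; rewrite inE => /eqP <-; rewrite -hiE.
      by exists q.
exact: feasible_gap_exists loi ihi bal.
Qed.

End Balance.

(** * Schedules attaining the bound on one side *)

Section Local.
Variable R : realType.

(** One side of the line seen from its own end, the agents being numbered inwards, so that a single
    construction serves both sides. *)
Record local := Local { lpos : nat -> R; lenergy : nat -> R }.

Definition setf (f : nat -> R) m x : nat -> R :=
  fun k => if k == m then x else f k.

Definition lperform (g : local) (act : action R nat) : local :=
  match act with
  | Move m x =>
      Local (setf (lpos g) m x)
            (setf (lenergy g) m (lenergy g m - `|x - lpos g m|))
  | Transfer m m' w =>
      Local (lpos g)
            (setf (setf (lenergy g) m' (lenergy g m' + w)) m (lenergy g m - w))
  end.

Definition lrun := foldl lperform.

(* The agents in use are those with index at most N. *)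
Definition llegal (N : nat) (g : local) (act : action R nat) : bool :=
  match act with
  | Move m x => (m <= N)%N && (`|x - lpos g m| <= lenergy g m)
  | Transfer m m' w => [&& (m <= N)%N, (m' <= N)%N, m != m',
      lpos g m == lpos g m', 0 <= w & w <= lenergy g m]
  end.

Fixpoint lfeasible N (g : local) (s : seq (action R nat)) : bool :=
  if s is act :: s' then llegal N g act && lfeasible N (lperform g act) s'
  else true.

Variables (A E : nat -> R) (lo i : nat).

Local Notation V := (surplus A E lo).
Local Notation d k := (A k.+1 - A k).
Local Arguments surplus : simpl never.

(* Energy held by the token on its arrival at A k, and the point where it is then
   joined by agent k.+1. *)
Definition stock k : R := if 0 <= V k then V k else 0.
Local Notation M := stock.
Definition meeting k : R := if d k <= M k then A k.+1 else A k + M k.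

(** First phase, before [lo]: an agent able to reach the next one brings it all the energy it has
    left; otherwise it stays in place. *)
Definition sweep_acts k : seq (action R nat) :=
  if (k.+1 <= lo)%N && (d k <= V k) then
    [:: Move k (A k.+1); Transfer k k.+1 (V k - d k)]
  else [::].

(** Second phase, running down from [i] to [lo] because an agent may have to be paid before it can
    pay: agent [m.+1] joins agent [m], clears its debt and waits there for the token. *)
Definition help_acts k : seq (action R nat) :=
  let m := (i - k.+1)%N in
  if (lo + k.+1 <= i)%N && ~~ (0 <= V m) then
    [:: Move m.+1 (A m); Transfer m.+1 m (0 - V m)]
  else [::].

(** Third phase: agent [k.+1] meets the token where the latter runs out of energy, or at [A k.+1] if
    it gets that far, and hands over everything it has left. *)
Definition carry_acts k : seq (action R nat) :=
  if (lo <= k)%N && (k.+1 <= i)%N then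
    [:: Move lo (meeting k); Move k.+1 (meeting k);
        Transfer k.+1 lo (M k.+1 + d k - M k); Move lo (A k.+1)]
  else [::].

Hypothesis A_mono : forall k, (k < i)%N -> A k < A k.+1.
Hypothesis E_ge0 : forall k, 0 <= E k.
Hypothesis lo_i : (lo <= i)%N.
Hypothesis V_ge0 : 0 <= V i.

Lemma stock_ge0 k : 0 <= M k.
Proof. by rewrite /M; case: ifP. Qed.

Definition swept k (g : local) := forall m, (k <= m <= i)%N ->
  lpos g m = A m /\ lenergy g m = if m == k then V m else E m.

(* Agent m once it has paid the debt of agent m.-1. *)
Definition aided m (g : local) :=
  if 0 <= V m.-1 then lpos g m = A m /\ lenergy g m = E m + (M m - V m)
  else lpos g m = A m.-1 /\ lenergy g m = M m + d m.-1.

(** State of the second phase when it has come down to [l]: the agents above [l] have paid, and [l]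
    has just received [M l - V l], which is its debt, or 0 if it has none. *)
Definition helped l (g : local) := forall m, (lo <= m <= i)%N ->
  if (m <= l)%N then
    lpos g m = A m /\ lenergy g m
      = (if m == lo then V m else E m) + (if m == l then M m - V m else 0)
  else aided m g.

Definition carried k (g : local) :=
  [/\ lpos g lo = A k, lenergy g lo = M k
    & forall m, (k < m <= i)%N -> aided m g].

Lemma surplusS k : V k.+1 = E k.+1 + transport (k < lo)%N (V k) (d k).
Proof. by []. Qed.

Lemma V_start : 0 <= V lo.
Proof.
case: lo => [|l]; first exact: E_ge0.
rewrite [surplus _ _ _ _]/(E l.+1 + _).
by rewrite ltnSn addr_ge0 // transport_free_ge0.
Qed.

Lemma V_next k : (lo <= k)%N -> V k.+1 = E k.+1 + transport false (V k) (d k).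
Proof. by move=> lok; rewrite surplusS ltnNge lok. Qed.

Lemma sweep_step k g : (k < lo)%N -> swept k g ->
  lfeasible i g (sweep_acts k) /\ swept k.+1 (lrun g (sweep_acts k)).
Proof.
move=> klo gk; have ki := leq_trans klo lo_i; have Ak := A_mono ki.
have [pk ek] : lpos g k = A k /\ lenergy g k = V k.
  by have [|] := gk k; rewrite ?leqnn ?eqxx // ltnW.
have [pk1 ek1] : lpos g k.+1 = A k.+1 /\ lenergy g k.+1 = E k.+1.
  by have [|] := gk k.+1; rewrite ?leqnSn // gtn_eqF.
have VE : V k.+1 = E k.+1 + if d k <= V k then V k - d k else 0.
  by rewrite surplusS klo /transport.
have rest m : (k.+1 < m <= i)%N -> lpos g m = A m /\ lenergy g m = E m.
  move=> /andP[km mi]; have [|] := gk m; first by rewrite mi ltnW // ltnW.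
  by rewrite gtn_eqF // ltnW.
rewrite /sweep_acts klo /=; case: ifP VE => dk VE /=; last first.
  split=> // m /andP[]; rewrite leq_eqVlt => /predU1P[<- _|km mi].
    by rewrite eqxx VE addr0.
  by rewrite gtn_eqF //; apply: rest; rewrite km.
have dpos : `|A k.+1 - A k| = d k by apply: dist_ge; apply: ltW.
have nk : (k == k.+1) = false by rewrite ltn_eqF.
have nk' : (k.+1 == k) = false by rewrite gtn_eqF.
rewrite /setf !eqxx ?nk ?nk' /= pk ek dpos (ltnW ki) ki pk1 ek1 eqxx dk /=.
rewrite lexx subr_ge0 dk; split=> // m /andP[km mi].
rewrite /= (gtn_eqF km); move: km; rewrite leq_eqVlt => /predU1P[<-|km].
  by rewrite !eqxx; split=> //; rewrite VE.
by rewrite !gtn_eqF //; apply: rest; rewrite km.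
Qed.

(** The descent can start at [i], which owes nothing since [0 <= V i]. *)
Lemma swept_helped g : swept lo g -> helped i g.
Proof.
move=> gl m mi; have [-> ->] := gl m mi; case/andP: mi => lom mi.
rewrite mi; split=> //; case: (m =P i) => [->|_]; last by rewrite addr0.
by rewrite /M V_ge0 subrr addr0.
Qed.

(** If [V m < 0], then [V m.+1 = E m.+1 + V m - 2 * d m], so agent [m.+1], once its own debt is
    cleared, holds [M m.+1 - V m + 2 * d m]. It walks [d m], pays [- V m] and keeps [M m.+1 + d m],
    just enough for the token to arrive at [A m.+1] with [M m.+1]. *)
Lemma help_step k g : (lo + k.+1 <= i)%N -> helped (i - k) g ->
  lfeasible i g (help_acts k) /\ helped (i - k.+1) (lrun g (help_acts k)).
Proof.
move=> ki gk; rewrite /help_acts ki /=; set m := (i - k.+1)%N.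
have eqm : (i - k = m.+1)%N by rewrite /m; lia.
have lom : (lo <= m)%N by rewrite /m; lia.
have mi : (m < i)%N by rewrite /m; lia.
rewrite eqm in gk; have Am := A_mono mi.
have [pm1 em1] : lpos g m.+1 = A m.+1 /\ lenergy g m.+1 = E m.+1 + (M m.+1 - V m.+1).
  have := gk m.+1; rewrite mi leqnn eqxx (leq_trans lom) // andbT => /(_ isT).
  by rewrite gtn_eqF.
have [pm em] : lpos g m = A m /\ lenergy g m = if m == lo then V m else E m.
  have := gk m; rewrite lom leqnSn (ltnW mi) => /(_ isT).
  by rewrite (ltn_eqF (ltnSn m)) addr0.
have VE := V_next lom; have Vlo := V_start.
case: (boolP (0 <= V m)) => Vm /=.
  split=> // l /andP[lol li]; have := gk l; rewrite lol li => /(_ isT).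
  case: (ltngtP l m.+1) => [lm|ml|->] /=.
  - have -> : (l <= m)%N by []; rewrite addr0; case: (l =P m) => [->|_].
      by rewrite /M Vm subrr addr0.
    by rewrite addr0.
  - by rewrite leqNgt (ltnW ml).
  - rewrite ltnn /aided /= Vm => _; split=> //.
rewrite -ltNge in Vm.
have nlo : (m == lo) = false by apply: contraTF Vm => /eqP->; rewrite -leNgt.
have dpos : `|A m - A m.+1| = d m by apply: dist_le; apply: ltW.
have {}VE : V m.+1 = E m.+1 + (V m - 2 * d m).
  rewrite VE /transport; case: leP => [|_]; first by move: Vm Am; lra.
  by rewrite leNgt Vm.
have M1 := stock_ge0 m.+1.
have nm : (m == m.+1) = false by rewrite ltn_eqF.
have nm' : (m.+1 == m) = false by rewrite gtn_eqF.
rewrite /setf !eqxx nm nm' /= pm1 em1 pm em nlo dpos mi (ltnW mi) eqxx /=.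
split; first by rewrite andbT; apply/and3P; split; move: VE M1 Vm Am; lra.
move=> l /andP[lol li] /=; have := gk l; rewrite lol li => /(_ isT).
case: (ltngtP l m.+1) => [lm|ml|->] /=.
- have -> : (l <= m)%N by []; rewrite addr0; case: (l =P m) => [->|_].
    move=> [-> _]; rewrite nlo; split=> //.
    by rewrite /M leNgt Vm /=; ring.
  by rewrite addr0.
- rewrite leqNgt (ltnW ml) /= /aided /=.
  by rewrite !(gtn_eqF ml) (gtn_eqF (ltnW ml)).
- rewrite ltnn /aided /= leNgt Vm /= eqxx => _; split=> //.
  by move: VE; lra.
Qed.

Lemma helped_carried g : helped lo g -> carried lo g.
Proof.
move=> gl; have := gl lo; rewrite leqnn lo_i !eqxx => /(_ isT)[pl el].
split=> //; first by rewrite el /M V_start; ring.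
move=> m /andP[lom mi]; have := gl m; rewrite mi (ltnW lom) => /(_ isT).
by rewrite leqNgt lom.
Qed.

Lemma carry_step k g : (lo <= k < i)%N -> carried k g ->
  lfeasible i g (carry_acts k) /\ carried k.+1 (lrun g (carry_acts k)).
Proof.
move=> /andP[lok ki] [pl el gk]; rewrite /carry_acts lok ki /=.
have Ak := A_mono ki; have VE := V_next lok; have M0 := stock_ge0 k.
have M1 := stock_ge0 k.+1; have Ek := E_ge0 k.+1.
have n1 : (lo == k.+1) = false by rewrite ltn_eqF.
have n2 : (k.+1 == lo) = false by rewrite gtn_eqF.
have := gk k.+1; rewrite ltnSn ki => /(_ isT); rewrite /aided /= => ak.
have dA : `|A k.+1 - A k| = d k by apply: dist_ge; apply: ltW.
set x := meeting k.
have [xk kx] : A k <= x /\ x <= A k.+1.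
  by rewrite /x /meeting; case: (leP (d k) (M k)) => ?; split; move: M0 Ak; lra.
have dl : `|x - A k| = x - A k by apply: dist_ge.
have dr : `|A k.+1 - x| = A k.+1 - x by apply: dist_ge.
have xM : x - A k <= M k.
  by rewrite /x /meeting; case: (leP (d k) (M k)) => ?; move: M0 Ak; lra.
(* Three cases: the token reaches [A k.+1] alone, it stops on the way and agent [k.+1] comes to it,
   or it has nothing and agent [k.+1] is already waiting at [A k]. In each of them the gift is all
   that agent [k.+1] has left. *)
have [w0 wle wr] : [/\ 0 <= M k.+1 + d k - M k, `|x - lpos g k.+1| <= lenergy g k.+1
    & lenergy g k.+1 - `|x - lpos g k.+1| = M k.+1 + d k - M k].
  move: ak VE M1 xM dl; rewrite /x /meeting /transport [stock k]/stock.
  case: (leP 0 (V k)) => Vk [-> ->].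
    rewrite [`|_ - A k.+1|]distrC.
    case: (leP (d k) (V k)) => h.
      rewrite subrr normr0 => VE M1 _ _.
      have -> : M k.+1 = V k.+1 by rewrite /stock VE; case: leP => // ?; exfalso; lra.
      by split; lra.
    have -> : `|A k.+1 - (A k + V k)| = d k - V k.
      by rewrite dist_ge; lra.
    by move=> VE M1 _ _; split; lra.
  case: (leP (d k) 0) => h; first by exfalso; move: Ak h; lra.
  rewrite addr0 subrr normr0 => _ M1 _ _; split; move: Ak M1; lra.
rewrite /setf !eqxx n1 n2 /= pl el dl dr xM wle wr w0 lexx.
rewrite (leq_trans lok (ltnW ki)) /=.
split; first by rewrite andbT; move: xM M1; lra.
split; rewrite /= ?eqxx ?n1 ?n2 //.
  by move: xM; rewrite ?pl ?dl ?dr; lra.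
move=> m /andP[km mi]; have := gk m; rewrite mi (ltnW km) => /(_ isT).
by rewrite /aided /= !(gtn_eqF km) !(gtn_eqF (leq_ltn_trans lok (ltnW km))).
Qed.

End Local.

(** * Execution of programs *)

Section LocalRuns.
Variable R : realType.
Implicit Types (g : local R) (s : seq (action R nat)).

Lemma lfeasible_cat N g s1 s2 :
  lfeasible N g (s1 ++ s2) = lfeasible N g s1 && lfeasible N (lrun g s1) s2.
Proof. by elim: s1 g => //= act s1 IHs g; rewrite IHs andbA. Qed.

Lemma lrun_cat g s1 s2 : lrun g (s1 ++ s2) = lrun (lrun g s1) s2.
Proof. exact: foldl_cat. Qed.

Definition all_acts n (acts : nat -> seq (action R nat)) :=
  flatten [seq acts k | k <- iota 0 n].

Lemma all_actsS n acts : all_acts n.+1 acts = all_acts n acts ++ acts n.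
Proof. by rewrite /all_acts -addn1 iotaD map_cat flatten_cat /= cats0. Qed.

Lemma lrun_all_acts N acts (I : nat -> local R -> Prop) n g :
    (forall k h, (k < n)%N -> I k h ->
      lfeasible N h (acts k) /\ I k.+1 (lrun h (acts k))) ->
    I 0%N g ->
  lfeasible N g (all_acts n acts) /\ I n (lrun g (all_acts n acts)).
Proof.
elim: n => [|n IHn] step Ig //.
have [|ok In] := IHn _ Ig; first by move=> k h kn; apply: step; apply: ltnW.
have [okn Inn] := step n _ (ltnSn n) In.
by rewrite all_actsS lfeasible_cat lrun_cat ok.
Qed.

Section Side.
Variables (A E : nat -> R) (lo i n : nat).
Hypothesis A_mono : forall k, (k < i)%N -> A k < A k.+1.
Hypothesis E_ge0 : forall k, 0 <= E k.
Hypothesis lo_i : (lo <= i)%N.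
Hypothesis i_n : (i < n)%N.
Hypothesis V_ge0 : 0 <= surplus A E lo i.

Definition side_acts := all_acts n (sweep_acts A E lo)
  ++ all_acts n (help_acts A E lo i) ++ all_acts n (carry_acts A E lo i).

Lemma side_acts_correct g : (forall m, lpos g m = A m) ->
    (forall m, lenergy g m = E m) ->
  [/\ lfeasible i g side_acts, lpos (lrun g side_acts) lo = A i
    & lenergy (lrun g side_acts) lo = surplus A E lo i].
Proof.
move=> gA gE.
(* As in the program, each phase loops over all the indices below [n] and emits nothing outside its
   range; clamping the index freezes the invariant there. *)
have [||ok1] := @lrun_all_acts i (sweep_acts A E lo)
  (fun k => swept A E lo i (minn k lo)) n g _ _.
- move=> k h kn; have [klo|lok] := ltnP k lo.
    have -> : (minn k.+1 lo = k.+1)%N by lia.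
    exact: sweep_step.
  have -> : (minn k.+1 lo = lo)%N by lia.
  by rewrite /sweep_acts ltnNge lok.
- move=> m; rewrite min0n gA gE => _; split=> //.
  by case: eqP => // ->.
have -> : (minn n lo = lo)%N by lia.
set g1 := lrun _ _ => /(swept_helped V_ge0) st1.
have [||ok2] := @lrun_all_acts i (help_acts A E lo i)
  (fun k => helped A E lo i (maxn lo (i - k))) n g1 _ _.
- move=> k h kn; have [ki|ik] := leqP (lo + k.+1) i.
    have -> : (maxn lo (i - k) = i - k)%N by lia.
    have -> : (maxn lo (i - k.+1) = i - k.+1)%N by lia.
    exact: help_step.
  rewrite /help_acts leqNgt ik /= => st; split=> //.
  by have -> : (maxn lo (i - k.+1) = maxn lo (i - k))%N by lia.
- by have -> : (maxn lo (i - 0) = i)%N by lia.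
have -> : (maxn lo (i - n) = lo)%N by lia.
set g2 := lrun _ _ => /(helped_carried E_ge0 lo_i) st2.
have [||ok3] := @lrun_all_acts i (carry_acts A E lo i)
  (fun k => carried A E lo i (minn i (maxn lo k))) n g2 _ _.
- move=> k h kn; case: (boolP (lo <= k < i)%N) => [/andP[lok ki]|nk].
    have -> : (minn i (maxn lo k) = k)%N by lia.
    have -> : (minn i (maxn lo k.+1) = k.+1)%N by lia.
    by apply: carry_step => //; rewrite lok.
  rewrite /carry_acts (negPf nk) /= => st; split=> //.
  by have -> : (minn i (maxn lo k.+1) = minn i (maxn lo k))%N by lia.
- by have -> : (minn i (maxn lo 0) = lo)%N by lia.
have -> : (minn i (maxn lo n) = i)%N by lia.
set g3 := lrun _ _ => -[pi ei _].
rewrite /side_acts !lfeasible_cat !lrun_cat ok1 ok2 ok3.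
by split=> //; rewrite -/g1 -/g2 -/g3 // ei /stock V_ge0.
Qed.

End Side.
End LocalRuns.

(** * From local schedules to schedules of the actual agents *)

Section Simulation.
Variables (R : realType) (n N : nat) (phi : nat -> 'I_n) (sg : R -> R).
Hypothesis phi_inj : forall m m', (m <= N)%N -> (m' <= N)%N ->
  phi m = phi m' -> m = m'.
Hypothesis sg_dist : forall x y, `|sg x - sg y| = `|x - y|.

Definition represents (c : config R n) (g : local R) := forall m, (m <= N)%N ->
  pos c (phi m) = sg (lpos g m) /\ energy c (phi m) = lenergy g m.

Definition globalize (act : action R nat) : action R 'I_n :=
  match act with
  | Move m x => Move (phi m) (sg x)
  | Transfer m m' w => Transfer (phi m) (phi m') w
  end.

(** Renaming the agents injectively and moving the points by an isometry preserves all costs. Since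
    the other agents are left untouched, the two sides can act one after the other. *)
Lemma simulate c g s : represents c g -> lfeasible N g s ->
  let c' := run c (map globalize s) in
  [/\ feasible c (map globalize s), represents c' (lrun g s) &
    forall k, (forall m, (m <= N)%N -> k != phi m) ->
      pos c' k = pos c k /\ energy c' k = energy c k].
Proof.
have phi_eq m m' : (m <= N)%N -> (m' <= N)%N -> (phi m == phi m') = (m == m').
  by move=> mN m'N; apply/eqP/eqP => [/phi_inj->|->].
elim: s c g => [|act s IHs] c g cg //= /andP[ok_act ok].
suff [lact cg' away] : [/\ legal c (globalize act),
    represents (perform c (globalize act)) (lperform g act)
  & forall k, (forall m, (m <= N)%N -> k != phi m) ->
    pos (perform c (globalize act)) k = pos c k /\
    energy (perform c (globalize act)) k = energy c k].
  have [-> IH2 IH3] := IHs _ _ cg' ok; rewrite lact; split=> // k kN.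
  by have [-> ->] := IH3 k kN; apply: away.
case: act ok_act {ok} => [m x|m m' w] /=.
  case/andP=> mN ok; have [pm em] := cg m mN.
  rewrite pm em sg_dist; split=> //.
    move=> l lN /=; rewrite /setf phi_eq //; have [pl el] := cg l lN.
    by case: eqP => // ->.
  by move=> k /(_ m mN) /negPf ->.
case/and5P=> mN m'N mm' pmm' /andP[w0 wm].
have [pm em] := cg m mN; have [pm' em'] := cg m' m'N.
rewrite phi_eq // mm' pm pm' em em' (eqP pmm') eqxx w0; split=> //.
  move=> l lN /=; rewrite /setf !phi_eq //; have [pl el] := cg l lN.
  by split=> //; case: eqP => // _; case: eqP.
by move=> k kN /=; rewrite !(negPf (kN _ _)).
Qed.

End Simulation.

(** * Functional semantics and linear running time of programs *)

Section Machine.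
Variable R : realType.
Implicit Types (s : store R) (c : cmd).

(** The effect of loop-free code as a function; [exec_den] relates it to [exec] for [straight]
    commands. *)
Fixpoint den c s : store R :=
  match c with
  | Skip | While _ _ => s
  | NSet b i x =>
      Store (upd (nmem s) b (neval s i) (neval s x)) (rmem s) (out s)
  | RSet b i x =>
      Store (nmem s) (upd (rmem s) b (neval s i) (reval s x)) (out s)
  | EmitMove i x =>
      Store (nmem s) (rmem s) (rcons (out s) (Move (neval s i) (reval s x)))
  | EmitTransfer i j w => Store (nmem s) (rmem s)
      (rcons (out s) (Transfer (neval s i) (neval s j) (reval s w)))
  | Seq c1 c2 => den c2 (den c1 s)
  | If b c1 c2 => if beval s b then den c1 s else den c2 s
  end.

Lemma den_if b c1 c2 s :
  den (If b c1 c2) s = if beval s b then den c1 s else den c2 s.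
Proof. by []. Qed.

Lemma den_seq c1 c2 s : den (Seq c1 c2) s = den c2 (den c1 s).
Proof. by []. Qed.

Lemma den_rset b i x s : den (RSet b i x) s =
  Store (nmem s) (upd (rmem s) b (neval s i) (reval s x)) (out s).
Proof. by []. Qed.

Lemma den_emit_move i x s : den (EmitMove i x) s =
  Store (nmem s) (rmem s) (rcons (out s) (Move (neval s i) (reval s x))).
Proof. by []. Qed.

Lemma den_emit_transfer i j w s : den (EmitTransfer i j w) s =
  Store (nmem s) (rmem s)
    (rcons (out s) (Transfer (neval s i) (neval s j) (reval s w))).
Proof. by []. Qed.

Lemma beval_rle s x y : beval s (BRle x y) = (reval s x <= reval s y).
Proof. by []. Qed.

Lemma beval_nle s x y : beval s (BNle x y) = (neval s x <= neval s y)%N.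
Proof. by []. Qed.

Lemma beval_not s x : beval s (BNot x) = ~~ beval s x.
Proof. by []. Qed.

Lemma beval_and s x y : beval s (BAnd x y) = beval s x && beval s y.
Proof. by []. Qed.

Lemma reval_add s x y : reval s (RAdd x y) = reval s x + reval s y.
Proof. by []. Qed.

Lemma reval_sub s x y : reval s (RSub x y) = reval s x - reval s y.
Proof. by []. Qed.

Lemma reval_mul s x y : reval s (RMul x y) = reval s x * reval s y.
Proof. by []. Qed.

Definition bevalE := (beval_rle, beval_nle, beval_not, beval_and).
Definition revalE := (reval_add, reval_sub, reval_mul).

Lemma neval_out s o x : neval (Store (nmem s) (rmem s) o) x = neval s x.
Proof. by elim: x => //= [b y ->|y -> z ->|y -> z ->]. Qed.

Lemma reval_out s o x : reval (Store (nmem s) (rmem s) o) x = reval s x.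
Proof.
elim: x => //= [b y|y -> z ->|y -> z ->|y -> z ->|y -> z ->] //.
by rewrite neval_out.
Qed.

Fixpoint straight c : bool :=
  match c with
  | While _ _ => false
  | Seq c1 c2 | If _ c1 c2 => straight c1 && straight c2
  | _ => true
  end.

(* The loops below count in the bank 6 up to n, which is in the bank 0. *)
Fixpoint keeps_counter c : bool :=
  match c with
  | NSet b _ _ => (b != 0%N) && (b != 6%N)
  | Seq c1 c2 | If _ c1 c2 => keeps_counter c1 && keeps_counter c2
  | _ => true
  end.

(* For a while loop, the cost of one iteration and of the final test. *)
Fixpoint cost c : nat :=
  match c with
  | Skip => 1
  | NSet _ i x => (ncost i + ncost x).+1
  | RSet _ i x | EmitMove i x => (ncost i + rcost x).+1
  | EmitTransfer i j w => (ncost i + ncost j + rcost w).+1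
  | Seq c1 c2 => cost c1 + cost c2
  | If b c1 c2 => (bcost b + (cost c1 + cost c2)).+1
  | While b c1 => (bcost b + bcost b + cost c1).+2
  end.

Lemma exec_den c s : straight c ->
  exists2 t, exec c s t (den c s) & (t <= cost c)%N.
Proof.
elim: c s => //=.
- by move=> s _; exists 1%N => //; apply: ExecSkip.
- by move=> b i x s _; exists (ncost i + ncost x).+1 => //; apply: ExecNSet.
- by move=> b i x s _; exists (ncost i + rcost x).+1 => //; apply: ExecRSet.
- by move=> i x s _; exists (ncost i + rcost x).+1 => //; apply: ExecEmitMove.
- move=> i j w s _; exists (ncost i + ncost j + rcost w).+1 => //.
  exact: ExecEmitTransfer.
- move=> c1 IH1 c2 IH2 s /andP[/IH1 {}IH1 /IH2 {}IH2].
  have [t1 e1 le1] := IH1 s; have [t2 e2 le2] := IH2 (den c1 s).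
  by exists (t1 + t2)%N; [apply: ExecSeq e1 e2 | apply: leq_add].
- move=> b c1 IH1 c2 IH2 s /andP[/IH1 {}IH1 /IH2 {}IH2].
  have [t e le] : exists2 t, exec (if beval s b then c1 else c2) s t
      (if beval s b then den c1 s else den c2 s) & (t <= cost c1 + cost c2)%N.
    case: ifP => _.
      by have [t e le] := IH1 s; exists t => //; apply: leq_trans le (leq_addr _ _).
    by have [t e le] := IH2 s; exists t => //; apply: leq_trans le (leq_addl _ _).
  by exists (bcost b + t).+1; [apply: ExecIf | rewrite ltnS leq_add2l].
Qed.

Lemma keeps_counterP c s b : keeps_counter c -> (b == 0%N) || (b == 6%N) ->
  nmem (den c s) b =1 nmem s b.
Proof.
move=> + hb; elim: c s => //=.
- move=> b' i x s /andP[b0 b6] k /=; rewrite /upd.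
  by case/orP: hb => /eqP->; rewrite eq_sym ?(negPf b0) ?(negPf b6).
- move=> c1 IH1 c2 IH2 s /andP[k1 k2] k.
  by rewrite (IH2 _ k2) (IH1 _ k1).
- move=> b' c1 IH1 c2 IH2 s /andP[k1 k2] k.
  by case: ifP => _; [apply: IH1 | apply: IH2].
Qed.

Definition cell b := NGet b (NConst 0).
Definition counter := cell 6.

Definition for_loop body :=
  Seq (NSet 6 (NConst 0) (NConst 0))
    (While (BNot (BNle (cell 0) counter))
      (Seq body (NSet 6 (NConst 0) (NAdd counter (NConst 1))))).

Definition set_counter s v := Store (upd (nmem s) 6 0%N v) (rmem s) (out s).

Variable n : nat.
Hypothesis n_gt0 : (0 < n)%N.

(** A Hoare triple with a time bound: a constant of the program text times [n]. Such bounds add up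
    under sequencing, and [0 < n] lets them absorb constant costs. *)
Definition runs c s (Q : store R -> Prop) :=
  exists t s', [/\ exec c s t s', (t <= cost c * n)%N & Q s'].

Lemma runs_straight c s (Q : store R -> Prop) :
  straight c -> Q (den c s) -> runs c s Q.
Proof.
move=> /(exec_den s)[t e le] Qs; exists t, (den c s); split=> //.
exact: leq_trans le (leq_pmulr _ n_gt0).
Qed.

Lemma runs_weaken c s (P Q : store R -> Prop) :
  runs c s P -> (forall s', P s' -> Q s') -> runs c s Q.
Proof. by move=> [t [s' [e le Ps]]] PQ; exists t, s'; split=> //; apply: PQ. Qed.

Lemma runs_seq c1 c2 s (P Q : store R -> Prop) :
  runs c1 s P -> (forall s', P s' -> runs c2 s' Q) -> runs (Seq c1 c2) s Q.
Proof.
move=> [t1 [s1 [e1 le1 /[swap]]]] /[apply] -[t2 [s2 [e2 le2 Q2]]].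
exists (t1 + t2)%N, s2; split=> //; first exact: ExecSeq e1 e2.
by rewrite mulnDl leq_add.
Qed.

Lemma runs_if b c1 c2 s (Q : store R -> Prop) :
    (beval s b -> runs c1 s Q) -> (~~ beval s b -> runs c2 s Q) ->
  runs (If b c1 c2) s Q.
Proof.
move=> H1 H2.
have [t [s' [e le Qs]]] : exists t s', [/\ exec (if beval s b then c1 else c2) s t s',
    (t <= (cost c1 + cost c2) * n)%N & Q s'].
  case: ifPn => [/H1|/H2] [t [s' [e le Qs]]]; exists t, s'; split=> //.
    by rewrite mulnDl (leq_trans le) ?leq_addr.
  by rewrite mulnDl (leq_trans le) ?leq_addl.
exists (bcost b + t).+1, s'; split=> //; first exact: ExecIf.
by move=> /=; nia.
Qed.

(** A straight body has constant cost, so [n] iterations and the final test take linear time. The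
    body must preserve [n] and the counter, and the invariant must not depend on the counter
    cell. *)
Lemma runs_for body s (I : nat -> store R -> Prop) :
    straight body -> keeps_counter body -> nmem s 0 0 = n ->
    (forall k s v, I k s -> I k (set_counter s v)) ->
    (forall k s, (k < n)%N -> nmem s 0 0 = n -> nmem s 6 0 = k -> I k s ->
      I k.+1 (den body s)) ->
    I 0%N s ->
  runs (for_loop body) s (fun s' => nmem s' 0 0 = n /\ I n s').
Proof.
move=> sb kb sn Icounter Istep I0.
apply: (@runs_seq _ _ _ (fun s' => [/\ nmem s' 0 0 = n, nmem s' 6 0 = 0%N & I 0%N s'])).
  by apply: runs_straight => //=; split=> //; apply: Icounter.
move=> {I0 sn} {}s [sn s0 I0].
set b := BNot _; set body' := Seq body _.
suff loop j k s1 : (k + j = n)%N -> nmem s1 0 0 = n -> nmem s1 6 0 = k -> I k s1 ->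
    exists t s2, [/\ exec (While b body') s1 t s2,
      (t <= (bcost b).+1 + (bcost b + cost body').+1 * j)%N,
      nmem s2 0 0 = n & I n s2].
  have [//|//|//|//|t [s2 [e le s2n I2]]] := loop n 0%N s _ _ _ _.
  exists t, s2; split=> //; apply: leq_trans le _ => /=.
  move: n_gt0; set B := bcost b; set D := (cost body + _)%N; nia.
elim: j k s1 => [|j IHj] k s1 kj s1n s1k Ik.
  exists (bcost b).+1, s1; rewrite muln0 addn0; split=> //.
    by apply: ExecWhileDone; rewrite /= s1n s1k -kj addn0 leqnn.
  by rewrite -kj addn0.
have kn : (k < n)%N by lia.
have sb' : straight body' by rewrite /= sb.
have [t1 e1 le1] := exec_den s1 sb'.
have sk : nmem (den body s1) 6 0 = k by rewrite keeps_counterP.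
have [||||t2 [s2 [e2 le2 s2n I2]]] := IHj k.+1 (den body' s1).
- by lia.
- by rewrite /= /upd /= keeps_counterP.
- by rewrite /= /upd /= sk addn1.
- by apply: Icounter; apply: Istep.
exists (bcost b + t1 + t2).+1, s2; split=> //; last by nia.
apply: ExecWhileLoop e1 e2.
by rewrite /= s1n s1k -ltnNge.
Qed.

End Machine.

(** * The program *)

(* With b = false the code works on the mirror image of the line: the index k
   stands for the agent n.-1 - k and the point x for - x. The token banks hold
   the indices of the two tokens, the meet banks those of the agents next to the
   gap where the tokens meet. *)
Section Code.
Variable b : bool.

Definition token_bank : nat := if b then 4 else 5.
Definition meet_bank : nat := if b then 7 else 8.
Definition surplus_bank : nat := if b then 2 else 5.
Definition stock_bank : nat := if b then 3 else 6.
Definition meeting_bank : nat := if b then 4 else 7.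

Definition succ_counter := NAdd counter (NConst 1).
Definition last_agent := NSub (cell 0) (NConst 1).
Definition agent_expr x := if b then x else NSub last_agent x.
Definition point_expr x := if b then x else RSub (RConst 0) x.
Definition pos_expr x := point_expr (RGet 0 (agent_expr x)).
Definition energy_expr x := RGet 1 (agent_expr x).
Definition gap_expr := RSub (pos_expr succ_counter) (pos_expr counter).
Definition surplus_expr := RGet surplus_bank counter.
Definition stock_expr := RGet stock_bank counter.

Definition set_stock :=
  If (BRle (RConst 0) surplus_expr)
    (RSet stock_bank counter surplus_expr) (RSet stock_bank counter (RConst 0)).

Definition set_meeting :=
  If (BRle gap_expr stock_expr)
    (RSet meeting_bank counter (pos_expr succ_counter))
    (RSet meeting_bank counter (RAdd (pos_expr counter) stock_expr)).

Definition set_surplus x :=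
  RSet surplus_bank succ_counter (RAdd (energy_expr succ_counter) x).

Definition next_surplus :=
  If (BRle gap_expr surplus_expr) (set_surplus (RSub surplus_expr gap_expr))
  (If (BNle succ_counter (cell token_bank)) (set_surplus (RConst 0))
  (If (BRle (RConst 0) surplus_expr)
    (set_surplus (RMul (RConst 2) (RSub surplus_expr gap_expr)))
    (set_surplus (RSub surplus_expr (RMul (RConst 2) gap_expr))))).

(** The last iteration also fills the entry [n] of the surplus bank. The cells it reads out of range
    agree with the default value of [extend] and with the truncated subtraction in [mirror]. *)
Definition table_code :=
  Seq (RSet surplus_bank (NConst 0) (energy_expr (NConst 0)))
    (for_loop (Seq set_stock (Seq set_meeting next_surplus))).

Definition sweep_code := for_loop
  (If (BAnd (BNle succ_counter (cell token_bank)) (BRle gap_expr surplus_expr))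
    (Seq (EmitMove (agent_expr counter) (point_expr (pos_expr succ_counter)))
      (EmitTransfer (agent_expr counter) (agent_expr succ_counter)
        (RSub surplus_expr gap_expr)))
    Skip).

Definition target_expr := NSub (cell meet_bank) succ_counter.

Definition help_code := for_loop
  (If (BAnd (BNle (NAdd (cell token_bank) succ_counter) (cell meet_bank))
        (BNot (BRle (RConst 0) (RGet surplus_bank target_expr))))
    (Seq (EmitMove (agent_expr (NAdd target_expr (NConst 1)))
           (point_expr (pos_expr target_expr)))
      (EmitTransfer (agent_expr (NAdd target_expr (NConst 1)))
        (agent_expr target_expr)
        (RSub (RConst 0) (RGet surplus_bank target_expr))))
    Skip).

Definition carry_code := for_loop
  (If (BAnd (BNle (cell token_bank) counter) (BNle succ_counter (cell meet_bank)))
    (Seq (EmitMove (agent_expr (cell token_bank))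
           (point_expr (RGet meeting_bank counter)))
    (Seq (EmitMove (agent_expr succ_counter)
           (point_expr (RGet meeting_bank counter)))
    (Seq (EmitTransfer (agent_expr succ_counter) (agent_expr (cell token_bank))
           (RSub (RAdd (RGet stock_bank succ_counter) gap_expr) stock_expr))
      (EmitMove (agent_expr (cell token_bank))
        (point_expr (pos_expr succ_counter))))))
    Skip).

Definition side_code := Seq sweep_code (Seq help_code carry_code).

End Code.

Definition mirror_counter := NSub last_agent succ_counter.

(** All gaps are tested and the last suitable one remains. The mirrored token bank holds
    [n.-1 - hi], so the second test amounts to [k < hi]. *)
Definition search_code := for_loop
  (If (BAnd (BNle (cell (token_bank true)) counter)
      (BAnd (BNle (NAdd succ_counter (cell (token_bank false))) last_agent)
      (BAnd (BRle (gap_expr true) (RAdd (surplus_expr true)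
               (RGet (surplus_bank false) mirror_counter)))
      (BAnd (BRle (RConst 0) (surplus_expr true))
            (BRle (RConst 0) (RGet (surplus_bank false) mirror_counter))))))
    (Seq (NSet 3 (NConst 0) (NConst 1))
    (Seq (NSet (meet_bank true) (NConst 0) counter)
         (NSet (meet_bank false) (NConst 0) mirror_counter)))
    Skip).

Definition final_code :=
  Seq (EmitMove (cell (token_bank true))
        (RGet (meeting_bank true) (cell (meet_bank true))))
      (EmitMove (agent_expr false (cell (token_bank false)))
        (RGet (meeting_bank true) (cell (meet_bank true)))).

Definition emit_code := Seq (side_code true) (Seq (side_code false) final_code).

Definition main_code :=
  Seq (table_code true) (Seq (table_code false) (Seq search_code
    (If (BNle (NConst 1) (cell 3)) emit_code Skip))).

Definition set_tokens x y :=
  Seq (NSet (token_bank true) (NConst 0) x)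
      (NSet (token_bank false) (NConst 0) (NSub last_agent y)).

Definition delivery_code :=
  Seq (If (BNle (cell 1) (cell 2)) (set_tokens (cell 1) (cell 2))
                                   (set_tokens (cell 2) (cell 1)))
    (If (BAnd (BNle (cell 1) (cell 2)) (BNle (cell 2) (cell 1)))
      (NSet 3 (NConst 0) (NConst 1)) main_code).

(** * Correctness of the program *)

Section Verification.
Variables (R : realType) (n : nat) (A E : nat -> R) (lo : bool -> nat).
Hypothesis n_gt0 : (0 < n)%N.
Implicit Types (s : store R) (b : bool).

Definition side_agent b m := if b then m else (n.-1 - m)%N.
Definition side_point b (x : R) : R := if b then x else 0 - x.
Definition side_pos b := if b then A else mirror n A.
Definition side_energy b := if b then E else reversal n E.
Local Notation V b := (surplus (side_pos b) (side_energy b) (lo b)).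
Local Notation M b := (stock (side_pos b) (side_energy b) (lo b)).
Local Notation X b := (meeting (side_pos b) (side_energy b) (lo b)).

Definition loaded s := [/\ nmem s 0 0 = n, rmem s 0 =1 A, rmem s 1 =1 E
  & forall b, nmem s (token_bank b) 0 = lo b].

Definition tabulated b s := forall m, (m < n)%N ->
  [/\ rmem s (surplus_bank b) m = V b m, rmem s (stock_bank b) m = M b m
    & rmem s (meeting_bank b) m = X b m].

(** Bank 6 is excepted because it holds the loop counter. *)
Definition same_nmem s0 s := forall r j : nat, r != 6%N -> nmem s r j = nmem s0 r j.

Lemma neval_agent b s x : nmem s 0 0 = n ->
  neval s (agent_expr b x) = side_agent b (neval s x).
Proof. by move=> sn; case: b => //=; rewrite sn subn1. Qed.

Lemma reval_point b s x : reval s (point_expr b x) = side_point b (reval s x).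
Proof. by case: b. Qed.

Lemma reval_pos b s x : nmem s 0 0 = n -> rmem s 0 =1 A ->
  reval s (pos_expr b x) = side_pos b (neval s x).
Proof.
move=> sn sA; rewrite /pos_expr reval_point /= neval_agent // sA.
by case: b => //=; rewrite /mirror sub0r.
Qed.

Lemma reval_energy b s x : nmem s 0 0 = n -> rmem s 1 =1 E ->
  reval s (energy_expr b x) = side_energy b (neval s x).
Proof. by move=> sn sE; rewrite /= neval_agent // sE; case: b. Qed.

Lemma reval_gap b s k : nmem s 0 0 = n -> rmem s 0 =1 A -> nmem s 6 0 = k ->
  reval s (gap_expr b) = side_pos b k.+1 - side_pos b k.
Proof. by move=> sn sA sk; rewrite /= !reval_pos //= sk addn1. Qed.

Definition table_bank b (r : nat) :=
  [|| r == surplus_bank b, r == stock_bank b | r == meeting_bank b].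

Lemma runs_table b s0 : loaded s0 ->
  runs n (table_code b) s0 (fun s => [/\ same_nmem s0 s, out s = out s0,
    tabulated b s
  & forall r j, ~~ table_bank b r -> rmem s r j = rmem s0 r j]).
Proof.
move=> [s0n s0A s0E s0lo].
(* The surpluses are known up to [k] included, one entry ahead of the two other banks. *)
pose I k s := [/\ same_nmem s0 s, out s = out s0,
  (forall m, (m <= k)%N -> rmem s (surplus_bank b) m = V b m),
  (forall m, (m < k)%N -> rmem s (stock_bank b) m = M b m /\
                          rmem s (meeting_bank b) m = X b m)
  & forall r j, ~~ table_bank b r -> rmem s r j = rmem s0 r j].
apply: (runs_seq (P := fun s => nmem s 0 0 = n /\ I 0%N s)).
  apply: runs_straight => //=; rewrite neval_agent //= s0E; split=> //; split=> //=.
  - by case=> // _; rewrite /upd !eqxx /=; case: (b).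
  - move=> r j; rewrite /table_bank /upd negb_or => /andP[/negPf -> _] //.
move=> {s0n} s [sn I0].
apply: (runs_weaken (P := fun s' => nmem s' 0 0 = n /\ I n s')); last first.
  move=> s' [_ [h1 h2 h3 h4 h5]]; split=> // m mn.
  by have [-> ->] := h4 m mn; rewrite h3 // ltnW.
apply: runs_for => //.
- move=> k s1 v [h1 h2 h3 h4 h5]; split=> // r j b6.
  by rewrite /= /upd (negPf b6) /= h1.
- move=> k {sn I0} {}s kn sn sk [h1 h2 h3 h4 h5].
  have [A0 E0] : ~~ table_bank b 0 /\ ~~ table_bank b 1 by case: (b).
  have sA : rmem s 0 =1 A by move=> j; rewrite h5.
  have sE : rmem s 1 =1 E by move=> j; rewrite h5.
  have slo : nmem s (token_bank b) 0 = lo b by rewrite h1 //; case: (b).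
  have Vk := h3 k (leqnn k).
  pose s1 := Store (nmem s) (upd (rmem s) (stock_bank b) k (M b k)) (out s).
  have E1 : den (set_stock b) s = s1.
    rewrite /= sk Vk /s1 /stock; case: ifP => //.
  pose s2 := Store (nmem s) (upd (rmem s1) (meeting_bank b) k (X b k)) (out s).
  have s1A : rmem s1 0 =1 A.
    by move=> j; rewrite /= /upd -sA; case: (b).
  have s2A : rmem s2 0 =1 A.
    by move=> j; rewrite /= /upd -sA; case: (b).
  have s2E : rmem s2 1 =1 E.
    by move=> j; rewrite /= /upd -sE; case: (b).
  have E2 : den (set_meeting b) s1 = s2.
    rewrite den_if bevalE (reval_gap b (sn : nmem s1 0 0 = n) s1A sk).
    rewrite !den_rset revalE !reval_pos //.
    rewrite [reval s1 (stock_expr b)]/= /upd /= sk addn1 !eqxx /=.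
    by rewrite /s2 /meeting /upd; case: ifP.
  have V2 : rmem s2 (surplus_bank b) k = V b k.
    by rewrite /= /upd -Vk; case: (b).
  pose s3 := Store (nmem s) (upd (rmem s2) (surplus_bank b) k.+1 (V b k.+1)) (out s).
  have E3 : den (next_surplus b) s2 = s3.
    have nS : neval s2 succ_counter = k.+1 by rewrite /= sk addn1.
    have rV : reval s2 (surplus_expr b) = V b k by rewrite -V2 -sk.
    have nl : neval s2 (cell (token_bank b)) = lo b := slo.
    rewrite /next_surplus /set_surplus !den_if !den_rset !bevalE.
    rewrite !(reval_add s2 (energy_expr _ _)) reval_energy //.
    rewrite !(reval_sub s2 _ (gap_expr b)) !reval_mul !(reval_sub s2 _ (gap_expr b)).
    rewrite (reval_sub s2 _ (RMul _ _)) reval_mul.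
    rewrite (reval_gap b (sn : nmem s2 0 0 = n) s2A sk).
    rewrite nS rV nl /s3 [surplus _ _ _ k.+1]/= /transport.
    by do 3!case: ifP => _ //.
  rewrite !den_seq E1 E2 E3; split=> //.
  + move=> m; rewrite leq_eqVlt => /predU1P[->|mk].
      by rewrite /= /upd !eqxx.
    by rewrite /= /upd (ltn_eqF mk) andbF -(h3 m mk); case: (b).
  + move=> m; rewrite ltnS leq_eqVlt => /predU1P[->|mk].
      by rewrite /= /upd !eqxx; case: (b).
    have [<- <-] := h4 m mk.
    by rewrite /= /upd (ltn_eqF mk) !andbF; case: (b).
  + move=> r j nb; rewrite -(h5 _ _ nb) /= /upd.
    by move: nb; rewrite /table_bank !negb_or => /and3P[/negPf-> /negPf-> /negPf->].
Qed.


Definition same_memory s0 s :=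
  same_nmem s0 s /\ forall r j, rmem s r j = rmem s0 r j.

Definition emitted b (act : action R nat) : action R nat :=
  match act with
  | Move m x => Move (side_agent b m) (side_point b x)
  | Transfer m m' w => Transfer (side_agent b m) (side_agent b m') w
  end.

(** Common shape of the three emission loops: the iteration [k] leaves the memory alone and appends
    the translation of [acts k]. *)
Lemma runs_emission b body acts s0 :
    straight body -> keeps_counter body -> nmem s0 0 0 = n ->
    (forall s k, (k < n)%N -> same_memory s0 s -> nmem s 6 0 = k ->
      den body s
      = Store (nmem s) (rmem s) (out s ++ [seq emitted b act | act <- acts k])) ->
  runs n (for_loop body) s0 (fun s => same_memory s0 s /\
    out s = out s0 ++ [seq emitted b act | act <- all_acts n acts]).
Proof.
move=> sb kb s0n step; pose I k s := same_memory s0 s /\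
  out s = out s0 ++ [seq emitted b act | act <- all_acts k acts].
apply: (runs_weaken (P := fun s' => nmem s' 0 0 = n /\ I n s')); last by move=> s' [].
apply: runs_for => //.
- move=> k s v [[h1 h2] h3]; split=> //; split=> // r j r6.
  by rewrite /= /upd (negPf r6) /= h1.
- move=> k s kn sn sk [h1 h2]; rewrite (step _ _ kn h1 sk); split=> //=.
  by rewrite h2 all_actsS map_cat catA.
- by split; rewrite ?cats0.
Qed.

Definition ready b i s :=
  [/\ loaded s, tabulated b s, nmem s (meet_bank b) 0 = i & (i < n)%N].

Lemma ready_same_memory b i s0 s : same_memory s0 s -> ready b i s0 -> ready b i s.
Proof.
move=> [h1 h2] [[sn sA sE slo] tab sm i_n]; split=> //.
- split; first by rewrite h1.
  + by move=> j; rewrite h2.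
  + by move=> j; rewrite h2.
  + by move=> b'; rewrite h1 //; case: b'.
- by move=> m /tab; rewrite !h2.
- by rewrite h1 //; case: (b).
Qed.

Section Emission.
Variables (b : bool) (i : nat) (s0 : store R).
Hypothesis s0_ready : ready b i s0.

Lemma store_out s o : o = out s -> Store (nmem s) (rmem s) o = s.
Proof. by case: s => ? ? ? /= ->. Qed.

Definition emission_post acts s := same_memory s0 s /\
  out s = out s0 ++ [seq emitted b act | act <- all_acts n acts].

Lemma runs_sweep : runs n (sweep_code b) s0
  (emission_post (sweep_acts (side_pos b) (side_energy b) (lo b))).
Proof.
apply: runs_emission; [by case: (b)|by case: (b)|by case: s0_ready => -[]|].
move=> s k kn /ready_same_memory/(_ s0_ready)[[sn sA sE slo] tab _ _] sk.
have nC : neval s counter = k := sk.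
have nS : neval s succ_counter = k.+1 by rewrite /= sk addn1.
have nl : neval s (cell (token_bank b)) = lo b := slo b.
have rV : reval s (surplus_expr b) = V b k by have [<- _ _] := tab k kn; rewrite -sk.
rewrite den_if !bevalE nS nl (reval_gap b sn sA sk) rV /sweep_acts.
case: ifP => _; last by rewrite store_out // cats0.
rewrite den_seq den_emit_move den_emit_transfer !neval_out !reval_out.
rewrite !neval_agent // nC nS reval_point reval_pos // nS reval_sub rV.
by rewrite (reval_gap b sn sA sk) -!cats1 -catA.
Qed.

Lemma runs_help : runs n (help_code b) s0
  (emission_post (help_acts (side_pos b) (side_energy b) (lo b) i)).
Proof.
apply: runs_emission; [by case: (b)|by case: (b)|by case: s0_ready => -[]|].
move=> s k kn /ready_same_memory/(_ s0_ready)[[sn sA sE slo] tab sm i_n] sk.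
have nS : neval s succ_counter = k.+1 by rewrite /= sk addn1.
have nS' : neval s (NAdd (cell (token_bank b)) succ_counter) = (lo b + k.+1)%N.
  by rewrite -nS -(slo b).
have nm : neval s (cell (meet_bank b)) = i := sm.
have nt : neval s (target_expr b) = (i - k.+1)%N by rewrite -nS -nm.
have nt1 : neval s (NAdd (target_expr b) (NConst 1)) = (i - k.+1).+1.
  by rewrite -[RHS]addn1 -nt.
have rV : reval s (RGet (surplus_bank b) (target_expr b)) = V b (i - k.+1).
  have [|<- _ _] := tab (i - k.+1)%N; first exact: leq_ltn_trans (leq_subr _ _) i_n.
  by rewrite -nt.
rewrite den_if !bevalE nS' nm rV /help_acts [reval s (RConst 0)]/=.
case: ifP => _; last by rewrite store_out // cats0.
rewrite den_seq den_emit_move den_emit_transfer !neval_out !reval_out.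
rewrite !neval_agent // nt nt1 reval_point reval_pos // nt reval_sub rV.
by rewrite -!cats1 -catA.
Qed.

Lemma runs_carry : runs n (carry_code b) s0
  (emission_post (carry_acts (side_pos b) (side_energy b) (lo b) i)).
Proof.
apply: runs_emission; [by case: (b)|by case: (b)|by case: s0_ready => -[]|].
move=> s k kn /ready_same_memory/(_ s0_ready)[[sn sA sE slo] tab sm i_n] sk.
have nC : neval s counter = k := sk.
have nS : neval s succ_counter = k.+1 by rewrite /= sk addn1.
have nl : neval s (cell (token_bank b)) = lo b := slo b.
have nm : neval s (cell (meet_bank b)) = i := sm.
rewrite den_if !bevalE nC nS nl nm /carry_acts.
case: ifP => [/andP[_ ki]|_]; last by rewrite store_out // cats0.
have [_ tM tX] := tab k kn; have [_ tM1 _] := tab k.+1 (leq_ltn_trans ki i_n).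
have rM : reval s (stock_expr b) = M b k by rewrite -tM -sk.
have rX : reval s (RGet (meeting_bank b) counter) = X b k by rewrite -tX -sk.
have rM1 : reval s (RGet (stock_bank b) succ_counter) = M b k.+1.
  by rewrite -tM1 -nS.
rewrite !den_seq !den_emit_move den_emit_transfer !neval_out !reval_out.
rewrite !neval_agent // nl nS (reval_point b s (pos_expr b _)) reval_pos // nS.
rewrite !(reval_point b s (RGet _ _)) reval_sub reval_add.
by rewrite rX rM rM1 (reval_gap b sn sA sk) -!cats1 -!catA.
Qed.

End Emission.

Lemma runs_side b i s0 : ready b i s0 ->
  runs n (side_code b) s0 (fun s => same_memory s0 s /\ out s = out s0
    ++ [seq emitted b act
       | act <- side_acts (side_pos b) (side_energy b) (lo b) i n]).
Proof.
have trans s1 s2 s3 : same_memory s1 s2 -> same_memory s2 s3 -> same_memory s1 s3.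
  move=> [h1 h2] [h3 h4]; split=> [r j r6|r j]; first by rewrite h3 // h1.
  by rewrite h4 h2.
move=> rd0; apply: runs_seq (runs_sweep rd0) _ => s1 [m1 o1].
have rd1 := ready_same_memory m1 rd0.
apply: runs_seq (runs_help rd1) _ => s2 [m2 o2].
have rd2 := ready_same_memory m2 rd1.
apply: runs_weaken (runs_carry rd2) _ => s3 [m3 o3].
split; first exact: trans (trans _ _ _ m1 m2) m3.
by rewrite o3 o2 o1 /side_acts !map_cat !catA.
Qed.

(** The number of agent [k.+1] when counting from the right end. *)
Definition mirror_index k := (n.-1 - k.+1)%N.

Definition good_gap k := [&& (lo true <= k)%N, (k.+1 + lo false <= n.-1)%N,
  A k.+1 - A k <= V true k + V false (mirror_index k),
  0 <= V true k & 0 <= V false (mirror_index k)].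

Definition found s k := [/\ nmem s 3 0 = 1%N, nmem s (meet_bank true) 0 = k,
  nmem s (meet_bank false) 0 = mirror_index k & good_gap k].

Lemma runs_search s0 : loaded s0 -> tabulated true s0 -> tabulated false s0 ->
    nmem s0 3 0 = 0%N ->
  runs n search_code s0 (fun s => [/\ loaded s, tabulated true s,
    tabulated false s, out s = out s0 &
    nmem s 3 0 = 0%N /\ (forall k, (k < n)%N -> ~~ good_gap k) \/
    exists2 k, (k < n)%N & found s k]).
Proof.
move=> ld0 tt0 tf0 s03; have [s0n _ _ _] := ld0.
pose I k s := [/\ loaded s, tabulated true s,
    tabulated false s, out s = out s0 &
    nmem s 3 0 = 0%N /\ (forall j, (j < k)%N -> ~~ good_gap j) \/
    exists2 j, (j < k)%N & found s j].
apply: (runs_weaken (P := fun s' => nmem s' 0 0 = n /\ I n s')); last by move=> s' [].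
apply: runs_for => //; last by split=> //; left.
- move=> k s v [[h1 h2 h3 h4] h5 h6 h7 h8]; split=> //.
  by split=> // b; rewrite -h4; case: b.
- move=> k s kn sn sk [ld tt tf so sr]; have [_ sA sE slo] := ld.
  have nC : neval s counter = k := sk.
  have nS : neval s succ_counter = k.+1 by rewrite /= sk addn1.
  have nL : neval s last_agent = n.-1 by rewrite /= sn subn1.
  have nl b : neval s (cell (token_bank b)) = lo b := slo b.
  have nS' : neval s (NAdd succ_counter (cell (token_bank false)))
      = (k.+1 + lo false)%N by rewrite -nS -(slo false).
  have nM : neval s mirror_counter = mirror_index k.
    by rewrite /mirror_index -nL -nS.
  have rV : reval s (surplus_expr true) = V true k.
    by have [<- _ _] := tt k kn; rewrite -sk.
  have rW : reval s (RGet (surplus_bank false) mirror_counter)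
      = V false (mirror_index k).
    have [|<- _ _] := tf (mirror_index k); first by rewrite /mirror_index; lia.
    by rewrite -nM.
  rewrite den_if !bevalE nC nS' nL nl reval_add rV rW.
  rewrite (reval_gap true sn sA sk) [reval s (RConst 0)]/= -/(good_gap k).
  case: ifPn => gk; last first.
    split=> //; case: sr => [[s3 ng]|[j jk fj]]; last first.
      by right; exists j; first exact: leqW.
    left; split=> // j; rewrite ltnS leq_eqVlt => /predU1P[->//|]; exact: ng.
  split=> //.
    by split=> // b; rewrite -slo; case: b.
  by right; exists k => //; split=> //; rewrite -nM.
Qed.

Definition schedule k :=
  [seq emitted true act
  | act <- side_acts (side_pos true) (side_energy true) (lo true) k n]
  ++ [seq emitted false act
     | act <- side_acts (side_pos false) (side_energy false) (lo false)
                (mirror_index k) n]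
  ++ [:: Move (lo true) (X true k); Move (n.-1 - lo false)%N (X true k)].

Lemma runs_main s0 : loaded s0 -> nmem s0 3 0 = 0%N -> out s0 = [::] ->
  runs n main_code s0 (fun s =>
    nmem s 3 0 = 0%N /\ (forall k, (k < n)%N -> ~~ good_gap k) \/
    exists k, [/\ (k < n)%N, nmem s 3 0 = 1%N, good_gap k & out s = schedule k]).
Proof.
move=> ld0 s03 s0o.
have keep b s s' : loaded s -> same_nmem s s' ->
    (forall r j, ~~ table_bank b r -> rmem s' r j = rmem s r j) -> loaded s'.
  move=> [sn sA sE slo] h1 h2; split; first by rewrite h1.
  + by move=> j; rewrite h2 ?sA //; case: b {h2}.
  + by move=> j; rewrite h2 ?sE //; case: b {h2}.
  + by move=> b'; rewrite h1 //; case: b'.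
apply: runs_seq (runs_table true ld0) _ => s1 [m1 o1 t1 r1].
have ld1 := keep _ _ _ ld0 m1 r1.
apply: runs_seq (runs_table false ld1) _ => s2 [m2 o2 t2 r2].
have ld2 := keep _ _ _ ld1 m2 r2.
have t1' : tabulated true s2 by move=> m /t1; rewrite !r2.
have s23 : nmem s2 3 0 = 0%N by rewrite m2 // m1.
apply: runs_seq (runs_search ld2 t1' t2 s23) _ => s3 [ld3 t3 t3' o3 found3].
apply: (runs_if n_gt0) => /= ans; last first.
  apply: runs_straight => //=.
  by case: found3 => [|[k _ [a3 _ _ _]]]; [left | rewrite a3 in ans].
case: found3 => [[a3]|[k kn [a3 km1 km2 gk]]]; first by rewrite a3 in ans.
have rd3 : ready true k s3 by [].
have rd3' : ready false (mirror_index k) s3.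
  by split=> //; rewrite /mirror_index; lia.
apply: runs_seq (runs_side rd3) _ => s4 [m4 o4].
have rd4 := ready_same_memory m4 rd3; have rd4' := ready_same_memory m4 rd3'.
apply: runs_seq (runs_side rd4') _ => s5 [m5 o5].
have [[s5n s5A s5E s5lo] t5 s5m _] := ready_same_memory m5 rd4.
apply: runs_straight => //; right; exists k; split=> //.
  by rewrite /= m5.1 // m4.1.
have xk : reval s5 (RGet (meeting_bank true) (cell (meet_bank true))) = X true k.
  by have [_ _ <-] := t5 k kn; rewrite -s5m.
have nl b : neval s5 (cell (token_bank b)) = lo b := s5lo b.
rewrite den_seq !den_emit_move neval_out !reval_out neval_agent // xk !nl.
by rewrite [out _]/= o5 o4 o3 o2 o1 s0o -!cats1 /schedule -!catA.
Qed.

End Verification.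

(** * Delivery *)

Section Delivery.
Variables (R : realType) (n : nat) (a e : 'I_n -> R).
Hypothesis a_mono : forall i j : 'I_n, (i < j)%N -> a i < a j.
Hypothesis e_ge0 : forall i : 'I_n, 0 <= e i.

Local Notation A := (extend a).
Local Notation E := (extend e).
Local Notation sP b := (side_pos n A b).
Local Notation sE b := (side_energy n E b).

Lemma side_agent_lt b m : (m < n)%N -> (side_agent n b m < n)%N.
Proof. by case: b => //=; lia. Qed.

Lemma side_pos_mono b k : (k.+1 < n)%N -> sP b k < sP b k.+1.
Proof.
move=> kn; case: b; first exact: extend_ltn.
by rewrite /side_pos /mirror ltrN2; apply: extend_ltn => //; lia.
Qed.

Lemma side_energy_ge0 b k : 0 <= sE b k.
Proof. by case: b; apply: extend_ge0. Qed.

Variable d0 : 'I_n.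
Definition agent b m : 'I_n := insubd d0 (side_agent n b m).

Lemma agentE b m : (m < n)%N -> agent b m = side_agent n b m :> nat.
Proof. by move=> mn; rewrite val_insubd side_agent_lt. Qed.

Lemma agent_inj b N m m' : (N < n)%N -> (m <= N)%N -> (m' <= N)%N ->
  agent b m = agent b m' -> m = m'.
Proof.
move=> Nn mN m'N /(congr1 (@nat_of_ord n)); rewrite !agentE; try lia.
by case: b => //=; lia.
Qed.

Lemma side_point_dist b (x y : R) :
  `|side_point b x - side_point b y| = `|x - y|.
Proof. by case: b => //=; rewrite !sub0r -opprD normrN. Qed.

(** A feasible local schedule only names indices up to [N < n], for which [agent] does not fall back
    on its default [d0]. *)
Lemma emitted_globalize b N (g : local R) s : (N < n)%N -> lfeasible N g s ->
  [seq emitted n b act | act <- s] =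
  [seq action_map (@nat_of_ord n) act
  | act <- [seq globalize (agent b) (side_point b) act | act <- s]].
Proof.
move=> Nn; elim: s g => //= act s IHs g /andP[ok /IHs ->]; congr (_ :: _).
case: act ok => [m x /andP[mN _]|m m' w /and3P[mN m'N _]] /=;
  by rewrite !agentE //; lia.
Qed.

Lemma side_schedule b lo i c : (lo <= i)%N -> (i < n)%N ->
    0 <= surplus (sP b) (sE b) lo i ->
    (forall m, (m <= i)%N -> pos c (agent b m) = side_point b (sP b m) /\
      energy c (agent b m) = sE b m) ->
  exists S : seq (action R 'I_n), let c' := run c S in
  [/\ [seq emitted n b act | act <- side_acts (sP b) (sE b) lo i n]
      = [seq action_map (@nat_of_ord n) act | act <- S],
      feasible c S,
      pos c' (agent b lo) = side_point b (sP b i)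
        /\ energy c' (agent b lo) = surplus (sP b) (sE b) lo i
    & forall k, (forall m, (m <= i)%N -> k != agent b m) ->
      pos c' k = pos c k /\ energy c' k = energy c k].
Proof.
move=> loi i_n Vi cg; pose g := Local (sP b) (sE b).
have [|||ok pl el] := @side_acts_correct R (sP b) (sE b) lo i n _
  (side_energy_ge0 b) loi i_n Vi g => //.
  by move=> k ki; apply: side_pos_mono; lia.
have inj m m' : (m <= i)%N -> (m' <= i)%N -> agent b m = agent b m' -> m = m'.
  exact: agent_inj i_n.
have [okS rep away] := simulate inj (side_point_dist b) (cg : represents i _ _ c g) ok.
have [pS eS] := rep lo loi.
exists [seq globalize (agent b) (side_point b) act
       | act <- side_acts (sP b) (sE b) lo i n] => /=.
by split=> //; [apply: emitted_globalize ok | rewrite pS eS pl el].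
Qed.

(** Since [lo] stands at [x], the closed path of [hi] contains both agents, and at its end [x] all
    the information on the path is shared. *)
Lemma meeting_informs (c : config R n) lo hi x p q : lo != hi -> pos c lo = x ->
    p \in [:: lo; hi] -> q \in [:: lo; hi] -> p \in info c p ->
  p \in info (perform c (Move hi x)) q.
Proof.
move=> lohi plo pin qin pp /=.
have qx : (if q == hi then x else pos c q) = x.
  by move: qin; rewrite !inE => /orP[] /eqP->; rewrite ?eqxx // (negPf lohi).
rewrite qx [between _ _ _](_ : _ = true); last first.
  by rewrite /between !lexx !andbT /= ?andbT le_total.
apply/bigcupP; exists p => //.
move: pin; rewrite !inE => /orP[] /eqP->; rewrite ?plo /between !lexx ?andbT ?andTb;
  exact: le_total.
Qed.

Definition token_index (lo hi : 'I_n) (b : bool) : nat :=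
  if b then val lo else (n.-1 - hi)%N.

Lemma good_gapE (lo hi : 'I_n) k :
  good_gap n A E (token_index lo hi) k = feasible_gap a e lo hi k.
Proof.
have := ltn_ord hi => hin.
rewrite /good_gap /feasible_gap /= -andbA; congr [&& _, _ & _]; lia.
Qed.

(** The left side acts, then the right side, on disjoint sets of agents; the tokens are then at both
    ends of the gap with their surpluses, and the balance condition lets them meet inside it. *)
Lemma schedule_delivers (lo hi p q : 'I_n) k :
    p \in [:: lo; hi] -> q \in [:: lo; hi] -> (k < n)%N ->
    good_gap n A E (token_index lo hi) k ->
  exists S : seq (action R 'I_n),
    schedule n A E (token_index lo hi) k = [seq action_map (@nat_of_ord n) act | act <- S]
    /\ delivers a e p q S.
Proof.
move=> pin qin kn /and5P[/= lok khi bal Vk Wk].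
have hin := ltn_ord hi; have lon := ltn_ord lo.
set k' := mirror_index n k in bal Wk.
have k1n : (k.+1 < n)%N by move: khi; lia.
have k'n : (k' < n)%N by rewrite /k' /mirror_index; lia.
have lok' : (n.-1 - hi <= k')%N by move: khi; rewrite /k' /mirror_index; lia.
set c0 := init_config a e.
have c0E b m : (m < n)%N -> pos c0 (agent b m) = side_point b (sP b m) /\
    energy c0 (agent b m) = sE b m.
  move=> mn; rewrite /= -!extendE agentE //; case: b => //=.
  by rewrite /mirror sub0r opprK.
have [|S1 [out1 ok1 [p1 e1] away1]] := @side_schedule true lo k c0 lok kn Vk.
  by move=> m mk; apply: c0E; lia.
set c1 := run c0 S1 in p1 e1 away1.
(* The mirrored indices up to [k'] are the agents from [k.+1] on, while the left side uses those up
   to [k]. *)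
have away_k m : (m <= k')%N -> forall j, (j <= k)%N -> agent false m != agent true j.
  move=> mk' j jk; apply/eqP => /(congr1 (@nat_of_ord n)); rewrite !agentE //=; try lia.
  by move: mk' jk; rewrite /k' /mirror_index; lia.
have [|S2 [out2 ok2 [p2 e2] away2]] := @side_schedule false _ k' c1 lok' k'n Wk.
  by move=> m mk'; have [-> ->] := away1 _ (away_k m mk'); apply: c0E; lia.
set c2 := run c1 S2 in p2 e2 away2.
have agent_lo : agent true lo = lo by apply: val_inj; rewrite /= agentE.
have agent_hi : agent false (n.-1 - hi) = hi.
  by apply: val_inj; rewrite /= agentE /=; lia.
rewrite agent_lo in p1 e1; rewrite agent_hi in p2 e2.
have lohi : (lo < hi)%N by move: lok khi; lia.
have [p1' e1'] : pos c2 lo = A k /\ energy c2 lo = surplus A E lo k.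
  have [|-> ->] := away2 lo; last by rewrite p1 e1.
  by move=> m mk'; rewrite -agent_lo eq_sym away_k.
have Ak' : side_point false (sP false k') = A k.+1.
  by rewrite /= /mirror sub0r opprK /k' /mirror_index; congr (extend _ _); lia.
rewrite Ak' in p2.
(* The left token goes as far as its energy allows, at most to [A k.+1]; by the balance of the gap
   the right token can cover the rest. *)
set x := meeting (sP true) (sE true) lo k.
have Ak : A k < A k.+1 by apply: extend_ltn.
have [x1 x2 x3 x4] : [/\ A k <= x, x <= A k.+1, x - A k <= surplus A E lo k
    & A k.+1 - x <= surplus (sP false) (sE false) (n.-1 - hi) k'].
  rewrite /x /meeting /stock /=; rewrite /= in Vk bal Wk; rewrite Vk.
  by case: (leP (A k.+1 - A k) (surplus A E lo k)) => h; split; lra.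
exists (S1 ++ S2 ++ [:: Move lo x; Move hi x]); split.
  rewrite (map_cat _ S1) (map_cat _ S2) -out1 -out2 /schedule [map _ [:: _; _]]/=.
  congr (_ ++ (_ ++ [:: _; Move _ _])).
  by move: hin; rewrite /token_index; clear; lia.
have lh : lo != hi by rewrite neq_ltn lohi.
set c3 := perform c2 (Move lo x).
have okS : feasible c0 (S1 ++ S2 ++ [:: Move lo x; Move hi x]).
  rewrite !feasible_cat ok1 -/c1 ok2 -/c2 /= eq_sym (negPf lh).
  by rewrite p1' e1' p2 e2 dist_ge // dist_le // x3 x4.
split=> //; exists (size (S1 ++ S2 ++ [:: Move lo x; Move hi x])).
rewrite take_size !run_cat -/c1 -/c2 [run c2 _]/(perform c3 (Move hi x)).
apply: (meeting_informs lh) => //; first by rewrite /= eqxx.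
apply: (subsetP (info_perform c2 (Move lo x) p)).
apply: (subsetP (info_run c1 S2 p)); apply: (subsetP (info_run c0 S1 p)).
by rewrite inE.
Qed.

End Delivery.

Theorem theorem1 (R : realType) :
  exists (prog : cmd) (C : nat),
    forall (n : nat) (a e : 'I_n -> R) (p q : 'I_n),
      (forall i j : 'I_n, (i < j)%N -> a i < a j) ->
      (forall i : 'I_n, 0 <= e i) ->
      exists (t : nat) (st : store R),
        [/\ exec prog (input a e p q) t st,
            (t <= C * n)%N,
            answer st <-> deliverable a e p q
          & deliverable a e p q ->
            exists s : seq (action R 'I_n),
              outputs st s /\ delivers a e p q s].
Proof.
exists delivery_code, (cost delivery_code) => n a e p q a_mono e_ge0.
have n0 : (0 < n)%N by apply: leq_ltn_trans (ltn_ord p).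
suff [t [s [ex le [H1 H2]]]] : runs n delivery_code (input a e p q) (fun st =>
    (answer st <-> deliverable a e p q) /\
    (deliverable a e p q -> exists s : seq (action R 'I_n),
      outputs st s /\ delivers a e p q s)).
  by exists t, s.
pose lo : 'I_n := if (p <= q)%N then p else q.
pose hi : 'I_n := if (p <= q)%N then q else p.
pose tok := token_index lo hi.
apply: (runs_seq (P := fun s => [/\ loaded n (extend a) (extend e) tok s,
    nmem s 1 0 = p, nmem s 2 0 = q, nmem s 3 0 = 0%N & out s = [::]])).
  apply: runs_straight => //=.
  by rewrite /tok /token_index /lo /hi; case: (leqP p q) => pq; split=> //;
    split=> // -[]; rewrite /upd /= ?subn1.
move=> s [ld s1 s2 s3 so]; apply: runs_if => //= [/andP[pq qp]|pq].
  have {pq qp} pq : p = q by apply: val_inj; move: pq qp => /=; rewrite s1 s2; lia.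
  have dl : delivers a e p q [::] by split=> //; exists 0%N; rewrite pq /= inE.
  apply: runs_straight => //; split; last by exists [::]; split.
  by split=> // _; exists [::].
rewrite s1 s2 -eqn_leq in pq.
have pq' : p != q by [].
have gap_of_deliverable : deliverable a e p q -> exists k, feasible_gap a e lo hi k.
  apply: deliverable_gap => //; rewrite /lo /hi; case: (boolP (p <= q)%N) => h.
    by left; split=> //; rewrite ltn_neqAle pq' h.
  by right; split=> //; rewrite ltnNge h.
apply: runs_weaken (runs_main n0 ld s3 so) _ => s' [[ans none]|[k [kn ans gk os]]].
  (* The search covers all [k < n], and a feasible gap satisfies [k < hi < n], so none can have been
     missed. *)
  have nd : ~ deliverable a e p q.
    move=> /gap_of_deliverable[k fk].
    have kn : (k < n)%N by move: fk (ltn_ord hi) => /and4P[/andP[_ +] _ _ _]; lia.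
    by have := none k kn; rewrite good_gapE fk.
  by rewrite /answer ans; split=> [|/nd//]; split=> // /nd.
have pin : p \in [:: lo; hi] by rewrite !inE /lo /hi; case: leqP; rewrite eqxx ?orbT.
have qin : q \in [:: lo; hi] by rewrite !inE /lo /hi; case: leqP; rewrite eqxx ?orbT.
have [S [outS dS]] := schedule_delivers a_mono e_ge0 p pin qin kn gk.
split; last by exists S; split=> //; rewrite /outputs os.
by rewrite /answer ans; split=> // _; exists S.
Qed.
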